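(* Let $X$ be a second countable, locally compact, Hausdorff space, let $\Gamma$ be an amenable countable discrete group, let $\beta$ be a (partial) action of $\Gamma$ on $X$, let $\mathcal{G}$ be the associated transformation groupoid with its canonical cocycle $c:\mathcal{G}\to\Gamma$, and let $M$ be a diagonal bimodule of $C_r^*(\mathcal{G})$. Then $M$ is spectral if and only if $M$ is $\alpha^c$-invariant (respectively, $\delta_c$-invariant) when $\Gamma$ is abelian (respectively, nonabelian).
   Context: A partial action $\beta$ of $\Gamma$ (identity $e$) on $X$ consists of open subsets $\{U_t\}_{t\in\Gamma}$ of $X$ and homeomorphisms $\beta_t:U_{t^{-1}}\to U_t$, $x\mapsto tx$, such that $U_e=X$, $\beta_e=\mathrm{id}_X$, and for all $t_1,t_2\in\Gamma$, $t_2(U_{(t_1t_2)^{-1}}\cap U_{t_2^{-1}})=U_{t_2}\cap U_{t_1^{-1}}$ and $(t_1t_2)x=t_1(t_2x)$ for $x\in U_{(t_1t_2)^{-1}}\cap U_{t_2^{-1}}$. (If all $U_t=X$ it is an action by homeomorphisms.) The transformation groupoid is $\mathcal{G}=\{(tx,t,x):t\in\Gamma,x\in U_{t^{-1}}\}$ with $s(tx,t,x)=x$, $r(tx,t,x)=tx$, $((t_1t_2)x,t_1,t_2x)(t_2x,t_2,x)=((t_1t_2)x,t_1t_2,x)$, $(tx,t,x)^{-1}=(x,t^{-1},tx)$, with the subspace topology from $X\times\Gamma\times X$; it is an amenable \'etale groupoid (second countable, locally compact, Hausdorff, $r,s$ local homeomorphisms) with unit space identified with $X$. The canonical continuous $1$-cocycle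 is $c(tx,t,x)=t$. $C_c(\mathcal{G})$ is a $*$-algebra with $f^*(\gamma)=\overline{f(\gamma^{-1})}$ and $(fg)(\gamma)=\sum_{\gamma'\in s^{-1}(s(\gamma))}f(\gamma\gamma'^{-1})g(\gamma')$; $C_r^*(\mathcal{G})$ is its completion in the norm $\|f\|_{\mathrm{red}}=\sup_{u\in\mathcal{G}^{(0)}}\|\mathrm{Ind}_u(f)\|$, where $\mathrm{Ind}_u(f)\xi(\gamma)=\sum_{\gamma'\in s^{-1}(u)}f(\gamma\gamma'^{-1})\xi(\gamma')$ on $\ell^2(s^{-1}(u))$. The inclusion $C_c(\mathcal{G})\subseteq C_0(\mathcal{G})$ extends to a norm-decreasing injective linear map $C_r^*(\mathcal{G})\to C_0(\mathcal{G})$, by which each $a\in C_r^*(\mathcal{G})$ is identified with a function $\gamma\mapsto a(\gamma)$. $C_0(\mathcal{G}^{(0)})$ is regarded as a $C^*$-subalgebra of $C_r^*(\mathcal{G})$. A diagonal bimodule is a norm closed subspace $M\subseteq C_r^*(\mathcal{G})$ with $ab,ba\in M$ for all $a\in M$, $b\in C_0(\mathcal{G}^{(0)})$. Put $\sigma(M)=\{\gamma\in\mathcal{G}:a(\gamma)\neq0\text{ for some }a\in M\}$ and, for open $P\subseteq\mathcal{G}$, $A(P)=\{a\in C_r^*(\mathcal{G}):a(\gamma)=0\ \forall\gamma\notin P\}$. $M$ is spectral if $M=A(\sigma(M))$. If $\Gamma$ is abelian, $\alpha^c$ is the action of the dual group $\widehat\Gamma$ on $C_r^*(\mathcal{G})$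 by automorphisms with $\alpha^c_\chi(a)(\gamma)=\chi(c(\gamma))a(\gamma)$; $M$ is $\alpha^c$-invariant if $\alpha^c_\chi(M)\subseteq M$ for all $\chi\in\widehat\Gamma$. If $\Gamma$ is nonabelian, with left regular representation $\lambda$, $\delta_c:C_r^*(\mathcal{G})\to C_r^*(\mathcal{G})\otimes_{\min}C_r^*(\Gamma)$ is the coaction (nondegenerate $*$-homomorphism) determined by $\delta_c(f)=f\otimes\lambda_t$ for $f\in C_c(\mathcal{G})$ with $\mathrm{supp}(f)\subseteq c^{-1}(t)$, $t\in\Gamma$; $M$ is $\delta_c$-invariant if $\delta_c(M)\subseteq\overline{\mathrm{span}}\{a\otimes b:a\in M,b\in C_r^*(\Gamma)\}$. *)

(* Defs.v *)
From HB Require Import structures.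
From mathcomp Require Import all_boot all_order all_algebra.
From mathcomp Require Import finmap.
From mathcomp Require Import all_classical all_reals all_analysis.
From mathcomp Require Import complex.
From mathcomp.analysis Require summability.

Set Implicit Arguments.
Unset Strict Implicit.
Unset Printing Implicit Defensive.

Import Order.TTheory GRing.Theory Num.Theory.
Import numFieldNormedType.Exports.


Local Open Scope classical_set_scope.
Local Open Scope ring_scope.

(** * Bounded operators on l2(I)

  A bounded operator T on the complex Hilbert space l2(I) is represented by its
  matrix T i j = <T delta_j, delta_i>.  A matrix comes from an operator of norm
  at most K iff its bilinear form is bounded by K on finitely supported
  vectors, which is [opnorm_le K]. *)

Section Operators.
Variable R : realType.
Local Notation C := (R[i]).

Definition opmatrix (I : choiceType) : Type := I -> I -> C.
HB.instance Definition _ (I : choiceType) := Choice.on (opmatrix I).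

Section OneSpace.
Variable I : choiceType.
Implicit Types (T S : opmatrix I) (A : set (opmatrix I)).

Definition opnorm_le (K : R) T : Prop :=
  0 <= K /\
  forall (F : {fset I}) (xi eta : I -> C),
    `|\sum_(i <- F) \sum_(j <- F) eta i * T i j * xi j| ^+ 2 <=
    (K ^+ 2)%:C%C * (\sum_(i <- F) `|eta i| ^+ 2)
                  * (\sum_(j <- F) `|xi j| ^+ 2).

Definition opzero : opmatrix I := fun _ _ => 0.
Definition opadd T S : opmatrix I := fun i j => T i j + S i j.
Definition opsub T S : opmatrix I := fun i j => T i j - S i j.
Definition opscale (z : C) T : opmatrix I := fun i j => z * T i j.
Definition opadj T : opmatrix I := fun i j => (T j i)^*.

(* The sum is the limit of the net of finite partial sums; for bounded
   operators it converges, and it is the matrix of the composition. *)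
Definition opmul T S : opmatrix I := fun i k =>
  summability.sum (R := C^o) (fun j => T i j * S j k).

Definition opclosure A : set (opmatrix I) :=
  [set T | forall e : R, 0 < e -> exists2 S, A S & opnorm_le e (opsub T S)].

Definition opspan A : set (opmatrix I) :=
  [set T | exists (n : nat) (z : 'I_n -> C) (S : 'I_n -> opmatrix I),
     (forall l, A (S l)) /\
     T = fun i j => \sum_(l < n) z l * S l i j].

End OneSpace.

(* The operator T (x) S on l2(I) (x) l2(J) = l2(I * J). *)
Definition optensor (I J : choiceType) (T : opmatrix I) (S : opmatrix J) :
    opmatrix (I * J)%type :=
  fun p q => T p.1 q.1 * S p.2 q.2.

(* When A and B are C*-algebras of operators this is their minimal tensor
   product. *)
Definition tensor_closure (I J : choiceType)
    (A : set (opmatrix I)) (B : set (opmatrix J)) : set (opmatrix (I * J)%type) :=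
  opclosure (opspan [set optensor T S | T in A & S in B]).

End Operators.

Section Groups.
Variables (R : realType) (Gam : groupType).
Local Notation C := (R[i]).

Definition abelian_group : Prop := forall s t : Gam, (s * t = t * s)%g.

Definition bounded_real_fun (f : Gam -> R) : Prop :=
  exists K : R, forall t, `|f t| <= K.

(* m is a left invariant mean on the bounded real functions on Gam; its values
   at unbounded functions are irrelevant. *)
Definition invariant_mean (m : (Gam -> R) -> R) : Prop :=
  [/\ forall f g, bounded_real_fun f -> bounded_real_fun g ->
        m (fun t => f t + g t) = m f + m g,
      forall (k : R) f, bounded_real_fun f -> m (fun t => k * f t) = k * m f,
      forall f, bounded_real_fun f -> (forall t, 0 <= f t) -> 0 <= m f,
      m (fun=> 1) = 1 &
      forall s f, bounded_real_fun f -> m (fun t => f (s^-1 * t)%g) = m f].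

Definition amenable_group : Prop := exists m, invariant_mean m.

(* The elements of the dual group of Gam (used for abelian Gam only). *)
Definition group_character (chi : Gam -> C) : Prop :=
  (forall s t, chi (s * t)%g = chi s * chi t) /\ (forall s, `|chi s| = 1).

(* lambda_t delta_r = delta_(t r) *)
Definition left_regular (t : Gam) : opmatrix R Gam :=
  fun s r => if s == (t * r)%g then 1 else 0.

Definition group_Cstar : set (opmatrix R Gam) :=
  opclosure (opspan (range left_regular)).

End Groups.

(* [pact t] is only meaningful on [pdom t^-1]. *)
Record partial_action (Gam : groupType) (X : topologicalType) := PartialAction {
  pdom : Gam -> set X;
  pact : Gam -> X -> X;
  pdom_open : forall t, open (pdom t);
  pact_bij : forall t, set_bij (pdom t^-1%g) (pdom t) (pact t);
  pact_cont : forall t, {within pdom t^-1%g, continuous (pact t)};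
  pact_inv_cont : forall t, exists g : X -> X,
    {within pdom t, continuous g} /\
    (forall x, pdom t^-1%g x -> g (pact t x) = x);
  pdom1 : pdom 1%g = [set: X];
  pact1 : forall x, pact 1%g x = x;
  pdomM : forall t1 t2,
    pact t2 @` (pdom (t1 * t2)^-1%g `&` pdom t2^-1%g)
    = pdom t2 `&` pdom t1^-1%g;
  pactM : forall t1 t2 x, pdom (t1 * t2)^-1%g x -> pdom t2^-1%g x ->
    pact (t1 * t2)%g x = pact t1 (pact t2 x)
}.

Section TransformationGroupoid.
Variables (Gam : groupType) (X : topologicalType) (beta : partial_action Gam X).
Local Notation U := (pdom beta).
Local Notation act := (pact beta).

Definition groupoid_set : set (X * discrete_topology Gam * X) :=
  [set g | U (g.1.2 : Gam)^-1%g g.2 /\ g.1.1 = act g.1.2 g.2].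

(* [set_type A] carries the subspace topology. *)
Definition groupoid : Type := set_type groupoid_set.
HB.instance Definition _ := Topological.on groupoid.

Definition mkgroupoid z (zG : groupoid_set z) : groupoid :=
  exist (fun z => z \in groupoid_set) z (mem_set zG).

Implicit Types g h : groupoid.

Definition src g : X := (val g).2.
Definition rng g : X := (val g).1.1.
Definition cocycle g : Gam := (val g).1.2.

Lemma groupoidP g : U (cocycle g)^-1%g (src g) /\ rng g = act (cocycle g) (src g).
Proof. exact: (set_mem (valP g)). Qed.

Lemma unit_subproof (x : X) : groupoid_set (x, 1%g, x).
Proof. by split => /=; rewrite ?invg1 ?pdom1 ?pact1. Qed.

Definition gunit (x : X) : groupoid := mkgroupoid (unit_subproof x).

Lemma inv_subproof g : groupoid_set (src g, (cocycle g)^-1%g, rng g).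
Proof.
have [Ug rg] := groupoidP g; have [ff _ _] := pact_bij beta (cocycle g).
split => /=; rewrite rg; first by rewrite invgK; apply: ff.
by rewrite -pactM ?mulVg ?pact1 // invg1 pdom1.
Qed.

Definition ginv g : groupoid := mkgroupoid (inv_subproof g).

Lemma mul_subproof g h : src g = rng h ->
  groupoid_set (rng g, (cocycle g * cocycle h)%g, src h).
Proof.
move=> sgrh; have [Ug rg] := groupoidP g; have [Uh rh] := groupoidP h.
have [ff inj _] := pact_bij beta (cocycle h).
have : (U (cocycle h) `&` U (cocycle g)^-1%g) (act (cocycle h) (src h)).
  by split; [exact: ff | rewrite -rh -sgrh].
rewrite -pdomM => -[x [Ux Vx]] /inj -/(_ (mem_set Vx) (mem_set Uh)) xE.
rewrite xE in Ux.
by split => //=; rewrite pactM // -rh -sgrh.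
Qed.

(* The product of composable g and h; the value [g] is junk otherwise. *)
Definition gmul g h : groupoid :=
  if pselect (src g = rng h) is left e
  then mkgroupoid (mul_subproof e) else g.

End TransformationGroupoid.

Section GroupoidAlgebra.
Variables (R : realType) (Gam : groupType) (X : topologicalType).
Variable beta : partial_action Gam X.
Local Notation C := (R[i]).
Local Notation G := (groupoid beta).

Definition support_of (f : G -> C) : set G := closure [set g | f g != 0].

Definition Cc (f : G -> C) : Prop :=
  continuous (f : G -> C^o) /\ compact (support_of f).

(* The operator xi |-> (g |-> \sum_(h | s h = s g) f (g h^-1) xi h) on l2(G),
   i.e. the direct sum over all units u of the Ind_u f on l2(s^-1(u)); so its
   norm is the reduced norm of f. *)
Definition Ind (f : G -> C) : opmatrix R G := fun g h =>
  if `[< src g = src h >] then f (gmul g (ginv h)) else 0.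

(* The completion of Cc(G) for the reduced norm, as the closure of its
   isometric image under Ind. *)
Definition Cr : set (opmatrix R G) := opclosure [set Ind f | f in Cc].

(* The function on G attached to an element of the reduced C*-algebra:
   <a delta_(s g), delta_g>, which is f g when a = Ind f with f in Cc(G). *)
Definition coef (a : opmatrix R G) (g : G) : C := a g (gunit beta (src g)).

Definition C0X (b : X -> C) : Prop :=
  continuous (b : X -> C^o) /\
  forall e : R, 0 < e -> exists2 K : set X, compact K &
    forall x, ~ K x -> `|b x| <= e%:C%C.

(* b, as a function on the unit space {(x, 1, x)} = c^-1(1), extended by 0. *)
Definition diag_op (b : X -> C) : opmatrix R G :=
  Ind (fun g => if cocycle g == 1%g then b (src g) else 0).

Definition diagonal_bimodule (M : set (opmatrix R G)) : Prop :=
  [/\ M `<=` Cr,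
      [/\ M (@opzero R G),
          forall a b, M a -> M b -> M (opadd a b) &
          forall z a, M a -> M (opscale z a)],
      opclosure M `<=` M &
      forall a b, M a -> C0X b ->
        M (opmul a (diag_op b)) /\ M (opmul (diag_op b) a)].

Definition sigma (M : set (opmatrix R G)) : set G :=
  [set g | exists2 a, M a & coef a g != 0].

Definition Aof (P : set G) : set (opmatrix R G) :=
  [set a | Cr a /\ forall g, ~ P g -> coef a g = 0].

Definition spectral (M : set (opmatrix R G)) : Prop := M = Aof (sigma M).

(* The element of Cr determined by its function g |-> chi (c g) * a g. *)
Definition alpha (chi : Gam -> C) (a : opmatrix R G) : opmatrix R G :=
  xget (@opzero R G)
    [set b | Cr b /\ forall g, coef b g = chi (cocycle g) * coef a g].

Definition alpha_invariant (M : set (opmatrix R G)) : Prop :=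
  forall chi, group_character chi -> alpha chi @` M `<=` M.

Definition tensor_alg : set (opmatrix R (G * Gam)%type) :=
  tensor_closure Cr (@group_Cstar R Gam).

(* The nondegenerate *-homomorphism Cr -> Cr (x)_min C*_r(Gam) such that
   f |-> f (x) lambda_t when supp f is contained in c^-1(t).  Being norm
   decreasing is automatic for *-homomorphisms, and is listed for convenience.
   Values outside Cr are irrelevant. *)
Definition is_coaction (delta : opmatrix R G -> opmatrix R (G * Gam)%type) : Prop :=
  [/\ [/\ forall a, Cr a -> tensor_alg (delta a),
          forall a b, Cr a -> Cr b -> delta (opadd a b) = opadd (delta a) (delta b),
          forall z a, Cr a -> delta (opscale z a) = opscale z (delta a),
          forall a b, Cr a -> Cr b -> delta (opmul a b) = opmul (delta a) (delta b) &
          forall a, Cr a -> delta (opadj a) = opadj (delta a)],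
      forall a K, Cr a -> opnorm_le K a -> opnorm_le K (delta a),
      tensor_alg `<=`
        opclosure (opspan [set opmul (delta a) z | a in Cr & z in tensor_alg]) &
      forall f t, Cc f -> support_of f `<=` [set g | cocycle g = t] ->
        delta (Ind f) = optensor (Ind f) (left_regular R t)].

Definition delta_c : opmatrix R G -> opmatrix R (G * Gam)%type :=
  xget (fun=> @opzero R (G * Gam)%type) is_coaction.

Definition delta_invariant (M : set (opmatrix R G)) : Prop :=
  delta_c @` M `<=` tensor_closure M (@group_Cstar R Gam).

End GroupoidAlgebra.

(* Main.v *)
Require Import Defs.
From mathcomp Require Import all_boot all_order all_algebra.
From mathcomp Require Import finmap.
From mathcomp Require Import all_classical all_reals all_analysis.
From mathcomp Require Import complex ring lra.
From mathcomp.analysis Require summability.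

Set Implicit Arguments.
Unset Strict Implicit.
Unset Printing Implicit Defensive.

Import Order.TTheory GRing.Theory Num.Theory.
Import numFieldNormedType.Exports.

Local Open Scope classical_set_scope.
Local Open Scope ring_scope.

(** Elements of the reduced algebra are norm limits of the right invariant
  matrices [Ind f], so they are determined by their functions [coef a] on the
  groupoid G, and multiplying [coef a] by [phi \o cocycle] is the Schur multiplier
  with kernel phi (s t^-1), [schur phi].  The multiplier of the point mass at t is
  the t-th Fourier coefficient [fourier t]: it restricts [coef a] to the fibre of
  the cocycle over t.  Multipliers whose kernel is a Gram matrix of vectors of
  norm at most one are contractions ([schur_contraction]); this covers the point
  masses, the characters, and the functions phi (g) = <lambda_g xi, xi>.

  The theorem reduces to the stability of M under the maps [fourier t].

  If M = A(P), then M is stable under every contractive multiplier, hence under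
  the Fourier coefficients and under the dual action, which is multiplication by
  characters.

  Conversely, let M be stable under the [fourier t] and let a be in
  A(sigma(M)).  In one fibre of the cocycle, a bisection on which the norm is
  the supremum norm, the members of M form a closed C_0(X)-module of functions.
  Such a module is determined by its support ([fibre_spectral]): a compact set on
  which a function b supported there is not small is covered by finitely many sets
  where some m_i in M is nonzero, and b is approximated by
  sum m_i (m_i^* b / (sum |m_i|^2 + eta)).  So every [fourier t a] is in M.  By
  amenability a is the limit of the finite sums of phi (t) [fourier t a], with
  phi (g) = <lambda_g xi, xi> finitely supported and close to 1 on a given finite
  set ([fejer]).  The vector xi is the square root of an almost invariant
  probability, which an invariant mean provides through Day's separation argument
  ([reiter]), hence through the Hahn-Banach theorem ([hahn_banach]).

  It remains to recover the Fourier coefficients from each invariance.  For the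
  dual action, integration over the dual group is replaced by finite averages: the
  multiplier (1 + chi (t)^-1 chi) / 2 is 1 at t, has modulus less than one at s as
  soon as chi (s) <> chi (t), and preserves an invariant M; high powers of
  products of such multipliers approximate the point mass at t on any finite set
  ([averager_small], [fourier_of_alpha]).  This needs characters to separate the
  points of a discrete abelian group, by extension of partial characters
  ([separating_character]).  For the coaction, [fourier t a] is a slice of
  delta (a) ([fourier_of_delta]).

  The coaction is conjugation of a (x) 1 by a unitary, which turns [fourier t a]
  into [fourier t a] (x) lambda_t.  Its axioms are verified in
  [dual_coaction_is_coaction], and uniqueness on the reduced algebra in
  [delta_cE]. *)

(** * Bounded bilinear forms *)

Section OperatorNorm.
Variable R : realType.
Local Notation C := (R[i]).
Local Notation "x %:C" := (real_complex R x) : ring_scope.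

Section OneSpace.
Variable I : choiceType.
Implicit Types (T S : opmatrix R I) (F : {fset I}) (xi eta : I -> C) (K : R).

Definition bform F T eta xi : C :=
  \sum_(i <- F) \sum_(j <- F) eta i * T i j * xi j.

Definition sqnorm F xi : C := \sum_(i <- F) `|xi i| ^+ 2.

Lemma sqnorm_ge0 F xi : 0 <= sqnorm F xi.
Proof. by apply: sumr_ge0 => i _; rewrite exprn_ge0. Qed.

Lemma sqnorm_eq0 F xi : sqnorm F xi = 0 -> forall i, i \in F -> xi i = 0.
Proof.
move=> /eqP; rewrite psumr_eq0; last by move=> i _; rewrite exprn_ge0.
by move=> /allP h i /h /=; rewrite sqrf_eq0 normr_eq0 => /eqP.
Qed.

(** The quadratic condition on the bilinear form is equivalent to a bound that is
  additive in the squared norms of the two vectors; this is the form in which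
  norms are estimated. *)
Lemma opnorm_leP K T : opnorm_le K T <-> 0 <= K /\
  forall F xi eta,
    `|bform F T eta xi| <= K%:C * ((sqnorm F eta + sqnorm F xi) / 2).
Proof.
split=> -[K0 h]; split=> // F xi eta; have KC : 0 <= K%:C by rewrite ler0c.
  have A0 := sqnorm_ge0 F eta; have D0 := sqnorm_ge0 F xi.
  have AD : 0 <= (sqnorm F eta + sqnorm F xi) / 2.
    by rewrite divr_ge0 // addr_ge0.
  rewrite -(@ler_pXn2r _ 2) ?nnegrE ?(mulr_ge0 KC AD) //.
  apply: (le_trans (h F xi eta)); rewrite -/(sqnorm F eta) -/(sqnorm F xi).
  move: (sqnorm F eta) (sqnorm F xi) A0 D0 {AD} => A D A0 D0.
  rewrite rmorphXn /= -mulrA exprMn ler_wpM2l ?exprn_ge0 // -subr_ge0.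
  have -> : ((A + D) / 2) ^+ 2 - A * D = ((A - D) / 2) ^+ 2 by field.
  by rewrite real_exprn_even_ge0 // rpredM ?rpredB ?rpredV ?ger0_real.
rewrite -/(bform F T eta xi) -/(sqnorm F eta) -/(sqnorm F xi).
have A0 := sqnorm_ge0 F eta; have D0 := sqnorm_ge0 F xi.
have [AE|An0] := eqVneq (sqnorm F eta) 0.
  rewrite AE mulr0 mul0r [bform _ _ _ _]big1_seq ?normr0 ?expr0n // => i /= iF.
  by rewrite big1 // => j _; rewrite (sqnorm_eq0 AE) ?mul0r.
have [DE|Dn0] := eqVneq (sqnorm F xi) 0.
  rewrite DE mulr0 [bform _ _ _ _]big1_seq ?normr0 ?expr0n // => i /= iF.
  by rewrite big1_seq // => j /= jF; rewrite (sqnorm_eq0 DE) ?mulr0.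
set A := sqnorm F eta; set D := sqnorm F xi.
have Ap : 0 < A by rewrite lt_def An0.
have Dp : 0 < D by rewrite lt_def Dn0.
(* Rescaling eta by s and xi by 1/s balances the two squared norms. *)
pose r := sqrtC (D / A); pose s := sqrtC r.
have rp : 0 < r by rewrite sqrtC_gt0 divr_gt0.
have sp : 0 < s by rewrite sqrtC_gt0.
have s2 : s ^+ 2 = r by rewrite sqrtCK.
have r2 : r ^+ 2 = D / A by rewrite sqrtCK.
have := h F (fun i => s^-1 * xi i) (fun i => s * eta i).
have -> : bform F T (fun i => s * eta i) (fun i => s^-1 * xi i) = bform F T eta xi.
  apply: eq_bigr => i _; apply: eq_bigr => j _.
  by field; rewrite gt_eqF.
have -> : sqnorm F (fun i => s * eta i) = r * A.
  rewrite /A /sqnorm mulr_sumr; apply: eq_bigr => i _.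
  by rewrite normrM exprMn (ger0_norm (ltW sp)) s2.
have -> : sqnorm F (fun i => s^-1 * xi i) = r^-1 * D.
  rewrite /D /sqnorm mulr_sumr; apply: eq_bigr => i _.
  by rewrite normrM exprMn normfV (ger0_norm (ltW sp)) exprVn s2.
have -> : r^-1 * D = r * A.
  have -> : D = r ^+ 2 * A by rewrite r2 divfK.
  by field; rewrite gt_eqF.
have -> : (r * A + r * A) / 2 = r * A by field.
move=> hb; rewrite -(@ler_pXn2r _ 2) ?nnegrE ?mulr_ge0 ?(ltW rp) // in hb.
apply: (le_trans hb); rewrite !exprMn r2 rmorphXn /= -mulrA.
by rewrite (_ : D / A * A ^+ 2 = A * D) //; field; rewrite gt_eqF.
Qed.

Lemma opnorm0 : opnorm_le 0 (@opzero R I).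
Proof.
apply/opnorm_leP; split=> // F xi eta; rewrite [bform _ _ _ _]big1 ?normr0 ?mul0r //.
by move=> i _; rewrite big1 // => j _; rewrite mulr0 mul0r.
Qed.

Lemma opnormD K L T S : opnorm_le K T -> opnorm_le L S ->
  opnorm_le (K + L) (opadd T S).
Proof.
move=> /opnorm_leP[K0 hT] /opnorm_leP[L0 hS]; apply/opnorm_leP.
split=> [|F xi eta]; first exact: addr_ge0.
have -> : bform F (opadd T S) eta xi = bform F T eta xi + bform F S eta xi.
  rewrite /bform -big_split; apply: eq_bigr => i _ /=.
  rewrite -big_split; apply: eq_bigr => j _ /=.
  by rewrite /opadd mulrDr mulrDl.
by rewrite (le_trans (ler_normD _ _)) // rmorphD /= mulrDl lerD.
Qed.

Lemma opnormZ K L (z : C) T : `|z| <= L%:C -> opnorm_le K T ->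
  opnorm_le (L * K) (opscale z T).
Proof.
move=> zL /opnorm_leP[K0 hT]; have L0 : 0 <= L.
  by rewrite -ler0c (le_trans _ zL).
apply/opnorm_leP; split=> [|F xi eta]; first exact: mulr_ge0.
have -> : bform F (opscale z T) eta xi = z * bform F T eta xi.
  rewrite /bform mulr_sumr; apply: eq_bigr => i _ /=.
  rewrite mulr_sumr; apply: eq_bigr => j _ /=.
  by rewrite /opscale; ring.
by rewrite normrM rmorphM /= -mulrA ler_pM.
Qed.

Lemma opnorm_leW K L T : K <= L -> opnorm_le K T -> opnorm_le L T.
Proof.
move=> KL /opnorm_leP[K0 hT]; apply/opnorm_leP.
split=> [|F xi eta]; first exact: le_trans KL.
apply: (le_trans (hT F xi eta)); rewrite ler_wpM2r ?lecR //.
by rewrite divr_ge0 // addr_ge0 // sqnorm_ge0.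
Qed.

Lemma opnorm_entry K T i j : opnorm_le K T -> `|T i j| <= K%:C.
Proof.
move=> /opnorm_leP[K0 hT].
have := hT [fset i; j]%fset (fun k => (k == j)%:R) (fun k => (k == i)%:R).
have sum1 (f : I -> C) k : k \in [fset i; j]%fset ->
    \sum_(l <- [fset i; j]%fset) (if l == k then f l else 0) = f k.
  move=> kF; rewrite (bigD1_seq k) //= eqxx.
  by rewrite big1 ?addr0 // => l /negPf ->.
have -> : bform [fset i; j]%fset T (fun k => (k == i)%:R) (fun k => (k == j)%:R)
  = T i j.
  rewrite -[RHS](sum1 (T ^~ j) i) ?inE ?eqxx //; apply: eq_bigr => k _.
  rewrite -[T k j](sum1 (T k) j) ?inE ?eqxx ?orbT //.
  case: (k == i); last by rewrite big1 // => l _; rewrite !mul0r.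
  apply: eq_bigr => l _; case: (l == j); rewrite ?mulr0 // mul1r mulr1 //.
have sqn1 k : k \in [fset i; j]%fset ->
    sqnorm [fset i; j]%fset (fun l => (l == k)%:R) = 1.
  move=> kF; rewrite -[RHS](sum1 (fun=> 1) k) //; apply: eq_bigr => l _.
  by case: (l == k); rewrite ?normr1 ?normr0 ?expr1n ?expr0n.
by rewrite !sqn1 ?inE ?eqxx ?orbT // (_ : (1 + 1) / 2 = 1) ?mulr1 //; field.
Qed.

Lemma opsub_self T : opsub T T = @opzero R I.
Proof. by apply/funext => i; apply/funext => j; rewrite /opsub subrr. Qed.

Lemma opnorm_sub_self T e : 0 <= e -> opnorm_le e (opsub T T).
Proof. by move=> e0; rewrite opsub_self; apply: (opnorm_leW e0 opnorm0). Qed.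

(** AM-GM bounds the term of (i, j) by K / 2 (|eta i|^2 + |xi j|^2), and in a
  monomial matrix each |eta i|^2 and each |xi j|^2 is counted at most once. *)
Lemma opnorm_monomial K T : 0 <= K -> (forall i j, `|T i j| <= K%:C) ->
  (forall i j j', T i j != 0 -> T i j' != 0 -> j = j') ->
  (forall i i' j, T i j != 0 -> T i' j != 0 -> i = i') -> opnorm_le K T.
Proof.
move=> K0 TK row col; apply/opnorm_leP; split=> // F xi eta.
have one (f : I -> bool) (a : C) : 0 <= a ->
    (forall i i', f i -> f i' -> i = i') ->
    \sum_(i <- F) (if f i then a else 0) <= a.
  move=> a0 fu; case: (pselect (exists2 i, i \in F & f i)) => [[i iF fi]|nf].
    rewrite (bigD1_seq i) //= fi big1 ?addr0 // => i' ne.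
    by case: ifP => // /fu /(_ fi) E; rewrite E eqxx in ne.
  rewrite big1_seq // => i /= iF; case: ifP => // fi; case: nf; by exists i.
have KC : 0 <= K%:C by rewrite ler0c.
rewrite (le_trans (ler_norm_sum _ _ _)) //.
apply: (@le_trans _ _ (\sum_(i <- F) \sum_(j <- F)
   (if T i j != 0 then K%:C * ((`|eta i| ^+ 2 + `|xi j| ^+ 2) / 2) else 0))).
  apply: ler_sum => i _; apply: (le_trans (ler_norm_sum _ _ _)).
  apply: ler_sum => j _; case: eqVneq => [->|_ /=]; first by rewrite mulr0 mul0r normr0.
  rewrite !normrM mulrAC mulrC ler_pM ?mulr_ge0 // -subr_ge0.
  have -> : (`|eta i| ^+ 2 + `|xi j| ^+ 2) / 2 - `|eta i| * `|xi j|
    = (`|eta i| - `|xi j|) ^+ 2 / 2 by field.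
  by rewrite divr_ge0 // real_exprn_even_ge0 // rpredB // ger0_real.
have -> : \sum_(i <- F) \sum_(j <- F)
   (if T i j != 0 then K%:C * ((`|eta i| ^+ 2 + `|xi j| ^+ 2) / 2) else 0)
  = \sum_(i <- F) \sum_(j <- F) (if T i j != 0 then K%:C * `|eta i| ^+ 2 / 2 else 0)
  + \sum_(j <- F) \sum_(i <- F) (if T i j != 0 then K%:C * `|xi j| ^+ 2 / 2 else 0).
  rewrite [X in _ + X]exchange_big -big_split; apply: eq_bigr => i _ /=.
  rewrite -big_split; apply: eq_bigr => j _ /=; case: ifP => _; rewrite ?addr0 //.
  by field.
rewrite mulrDl mulrDr !mulr_suml !mulr_sumr.
apply: lerD; apply: ler_sum => i _; rewrite mulrA; apply: one.
- by rewrite divr_ge0 // mulr_ge0 // exprn_ge0.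
- by move=> j j'; apply: row.
- by rewrite divr_ge0 // mulr_ge0 // exprn_ge0.
- by move=> j j'; apply: col.
Qed.

End OneSpace.
End OperatorNorm.

(** * Norm estimates for compressions and tensor products *)

Section OperatorNorm2.
Variable R : realType.
Local Notation C := (R[i]).
Local Notation "x %:C" := (real_complex R x) : ring_scope.

Section Pull.
Variables (I J : choiceType).
Implicit Types (T : opmatrix R I) (K : R).

Lemma pushforward_sum (F : {fset J}) (u : J -> I) (eta : J -> C) (F' : {fset I})
    (g : I -> C) : (forall i, i \in F -> u i \in F') ->
  \sum_(a <- F') (\sum_(i <- F | u i == a) eta i) * g a =
  \sum_(i <- F) eta i * g (u i).
Proof.
move=> uF; under eq_bigr do rewrite big_mkcond mulr_suml.
rewrite exchange_big; apply: eq_big_seq => i iF /=.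
rewrite (bigD1_seq (u i)) ?uF //= eqxx big1 ?addr0 // => a.
by rewrite eq_sym => /negPf ->; rewrite mul0r.
Qed.

Lemma pushforward_sqnorm (F : {fset J}) (u : J -> I) (eta : J -> C)
    (F' : {fset I}) : (forall i, i \in F -> u i \in F') ->
  {in F &, forall i j, eta i != 0 -> eta j != 0 -> u i = u j -> i = j} ->
  sqnorm F' (fun a => \sum_(i <- F | u i == a) eta i) = sqnorm F eta.
Proof.
move=> uF uI; rewrite /sqnorm.
transitivity (\sum_(a <- F') (\sum_(i <- F | u i == a) `|eta i| ^+ 2) * 1);
  last by rewrite pushforward_sum //; under eq_bigr do rewrite mulr1.
apply: eq_bigr => a _; rewrite mulr1.
case: (pselect (exists2 i, i \in F & (u i == a) && (eta i != 0))); last first.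
  move=> no; have z i : i \in F -> u i == a -> eta i = 0.
    move=> iF ua; apply/eqP/negP => /negP n0; case: no; exists i => //.
    by rewrite ua.
  rewrite !big1_seq ?normr0 ?expr0n // => i /andP[ua iF]; rewrite (z i) //.
  by rewrite normr0 expr0n.
move=> [i iF /andP[ua in0]].
have only_i j : j \in F -> j != i -> u j == a -> eta j = 0.
  move=> jF ji uj; apply/eqP/negP => /negP jn0.
  by rewrite (uI j i) ?eqxx // in ji; rewrite (eqP ua) (eqP uj).
rewrite big_mkcond [in RHS]big_mkcond (bigD1_seq i) //= [in RHS](bigD1_seq i) //=.
rewrite ua !big1_seq ?addr0 // => j /andP[ji jF]; case: ifP => // uj.
  by rewrite only_i // normr0 expr0n.
by rewrite only_i.
Qed.

(** Compressing the bilinear form by maps that are injective where the vectors do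
  not vanish amounts to pushing the vectors forward, which keeps their norms. *)
Lemma form_pull K T (F : {fset J}) (u v : J -> I) (eta xi : J -> C) :
  opnorm_le K T ->
  {in F &, forall i j, eta i != 0 -> eta j != 0 -> u i = u j -> i = j} ->
  {in F &, forall i j, xi i != 0 -> xi j != 0 -> v i = v j -> i = j} ->
  `|\sum_(i <- F) \sum_(j <- F) eta i * T (u i) (v j) * xi j|
  <= K%:C * ((sqnorm F eta + sqnorm F xi) / 2).
Proof.
move=> /opnorm_leP[K0 hT] uI vI.
pose F' := ([fset u i | i in F] `|` [fset v i | i in F])%fset.
have uF i : i \in F -> u i \in F'.
  by move=> iF; rewrite inE; apply/orP; left; apply: in_imfset.
have vF i : i \in F -> v i \in F'.
  by move=> iF; rewrite inE; apply/orP; right; apply: in_imfset.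
have := hT F' (fun a => \sum_(i <- F | v i == a) xi i)
              (fun a => \sum_(i <- F | u i == a) eta i).
rewrite !pushforward_sqnorm //; congr (`|_| <= _).
transitivity (\sum_(a <- F') (\sum_(i <- F | u i == a) eta i) *
    (\sum_(b <- F') (\sum_(j <- F | v j == b) xi j) * T a b)).
  apply: eq_bigr => a _; rewrite mulr_sumr; apply: eq_bigr => b _ /=.
  by rewrite [X in _ = _ * X]mulrC mulrA.
rewrite pushforward_sum //; apply: eq_bigr => i _.
rewrite pushforward_sum // mulr_sumr; apply: eq_bigr => j _ /=.
by rewrite [X in _ * X]mulrC mulrA.
Qed.

(** Compressing T by partial isometries and multiplying it by a positive definite
  kernel both have the form sum_w x_w T y_w, and the bound
  K / 2 (|eta|^2 + |xi|^2) can be summed over w. *)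
Lemma opnorm_pull (Q : Type) K T (T' : opmatrix R J) : opnorm_le K T ->
  (forall F : {fset J}, exists (W : seq Q) (x y : Q -> J -> C) (u v : Q -> J -> I),
    [/\ {in F &, forall i j,
           T' i j = \sum_(w <- W) x w i * T (u w i) (v w j) * y w j},
        forall w, {in F &, forall i j,
           x w i != 0 -> x w j != 0 -> u w i = u w j -> i = j},
        forall w, {in F &, forall i j,
           y w i != 0 -> y w j != 0 -> v w i = v w j -> i = j},
        {in F, forall i, \sum_(w <- W) `|x w i| ^+ 2 <= 1} &
        {in F, forall i, \sum_(w <- W) `|y w i| ^+ 2 <= 1}]) ->
  opnorm_le K T'.
Proof.
move=> TK hW; have [K0 _] := TK; apply/opnorm_leP; split=> // F xi eta.
have KC : 0 <= K%:C by rewrite ler0c.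
have [W [x [y [u [v [T'E uI vI x1 y1]]]]]] := hW F.
have -> : bform F T' eta xi = \sum_(w <- W) \sum_(i <- F) \sum_(j <- F)
    (eta i * x w i) * T (u w i) (v w j) * (y w j * xi j).
  rewrite exchange_big; apply: eq_big_seq => i iF /=.
  rewrite exchange_big; apply: eq_big_seq => j jF /=.
  rewrite T'E // mulr_sumr mulr_suml; apply: eq_bigr => w _; ring.
rewrite (le_trans (ler_norm_sum _ _ _)) //.
apply: (@le_trans _ _ (\sum_(w <- W) K%:C *
   ((sqnorm F (fun i => eta i * x w i) + sqnorm F (fun j => y w j * xi j)) / 2))).
  apply: ler_sum => w _; apply: (form_pull TK).
    move=> i j iF jF; rewrite !mulf_eq0 !negb_or => /andP[_ xi0] /andP[_ xj0].
    exact: uI xi0 xj0.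
  move=> i j iF jF; rewrite !mulf_eq0 !negb_or => /andP[xi0 _] /andP[xj0 _].
  exact: vI xi0 xj0.
rewrite -mulr_sumr ler_wpM2l // -mulr_suml ler_wpM2r // big_split /=.
apply: lerD; rewrite exchange_big /= [sqnorm _ _]big_seq big_seq;
    apply: ler_sum => i iF.
  under eq_bigr do rewrite normrM exprMn.
  by rewrite -mulr_sumr ler_piMr ?x1 // exprn_ge0.
under eq_bigr do rewrite normrM exprMn.
by rewrite -mulr_suml ler_piMl ?y1 // exprn_ge0.
Qed.

End Pull.

Lemma opnorm_col_sq (I : choiceType) K (T : opmatrix R I) (F : {fset I})
    (eta : I -> C) : 0 < K -> opnorm_le K T ->
  \sum_(j <- F) `|\sum_(i <- F) eta i * T i j| ^+ 2 <= (K ^+ 2)%:C * sqnorm F eta.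
Proof.
move=> K0 [_ hT]; set Z := BIG_F.
have := hT F (fun j => (\sum_(i <- F) eta i * T i j)^*) eta.
rewrite -/(sqnorm F eta).
have -> : \sum_(i <- F) \sum_(j <- F)
     eta i * T i j * (\sum_(i <- F) eta i * T i j)^* = \sum_(j <- F) Z j.
  rewrite exchange_big; apply: eq_bigr => j _ /=.
  by rewrite -mulr_suml -normCK.
under [X in _ <= _ * X -> _]eq_bigr do rewrite norm_conjC.
have Z0 : 0 <= \sum_(j <- F) Z j by apply: sumr_ge0 => j _; rewrite exprn_ge0.
rewrite ger0_norm // -/Z.
have [->|Zn0] := eqVneq (\sum_(j <- F) Z j) 0.
  by move=> _; rewrite mulr_ge0 ?sqnorm_ge0 // ler0c exprn_ge0 // ltW.
by rewrite expr2 ler_pM2r // lt_def Zn0.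
Qed.

Lemma opnorm_tr (I : choiceType) K (T : opmatrix R I) :
  opnorm_le K T -> opnorm_le K (fun i j => T j i).
Proof.
move=> /opnorm_leP[K0 h]; apply/opnorm_leP; split=> // F xi eta.
have := h F eta xi; rewrite [sqnorm F xi + _]addrC; congr (`|_| <= _).
rewrite /bform exchange_big; apply: eq_bigr => i _; apply: eq_bigr => j _ /=.
by ring.
Qed.

(** Factor T (x) S as (T (x) 1) (1 (x) S): on a finite box the bilinear form is
  the pairing of eta (T (x) 1) with (1 (x) S) xi. *)
Lemma opnorm_tensor (I J : choiceType) K L (T : opmatrix R I) (S : opmatrix R J) :
  0 < K -> 0 < L -> opnorm_le K T -> opnorm_le L S ->
  opnorm_le (K * L) (optensor T S).
Proof.
move=> K0 L0 TK SL; apply/opnorm_leP; split=> [|F xi eta].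
  by rewrite mulr_ge0 // ltW.
have KC : 0 < K%:C by rewrite ltcR.
have LC : 0 < L%:C by rewrite ltcR.
pose F1 := [fset p.1 | p in F]%fset; pose F2 := [fset p.2 | p in F]%fset.
pose ext (f : I * J -> C) p := if p \in F then f p else 0.
have extE (f : I * J -> C) : \sum_(p <- F) f p =
    \sum_(i <- F1) \sum_(s <- F2) ext f (i, s).
  have sub : (F `<=` F1 `*` F2)%fset.
    by apply/fsubsetP => p pF; rewrite in_fsetM; apply/andP; split; apply: in_imfset.
  transitivity (\sum_(p <- F) ext f p).
    by apply: eq_big_seq => p pF; rewrite /ext pF.
  rewrite (big_fset_incl _ sub) /=; last by move=> p _ /negPf; rewrite /ext => ->.
  rewrite -((@big_allpairs _ 0 +%R _ _ F1 F2 (ext f))); apply: perm_big; apply: uniq_perm.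
  - exact: fset_uniq.
  - by apply: allpairs_uniq => // -[? ?] [? ?] _ _ /= [-> ->].
  - move=> [i s]; rewrite in_fsetM /=; apply/andP/allpairsP => [[h1 h2]|[[i' s'] [h1 h2 [-> ->]]] //].
    by exists (i, s).
pose zeta q1 s := \sum_(p1 <- F1) ext eta (p1, s) * T p1 q1.
pose theta q1 s := \sum_(q2 <- F2) S s q2 * ext xi (q1, q2).
have -> : bform F (optensor T S) eta xi =
    \sum_(q1 <- F1) \sum_(s <- F2) zeta q1 s * theta q1 s.
  rewrite /bform extE.
  transitivity (\sum_(p1 <- F1) \sum_(s <- F2) \sum_(q1 <- F1) \sum_(q2 <- F2)
    ext eta (p1, s) * T p1 q1 * (S s q2 * ext xi (q1, q2))).
    apply: eq_bigr => p1 _; apply: eq_bigr => s _.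
    rewrite /ext; case: ifP => _; last first.
      by rewrite big1 // => q1 _; rewrite big1 // => q2 _; rewrite !mul0r.
    rewrite extE; apply: eq_bigr => q1 _; apply: eq_bigr => q2 _.
    by rewrite /ext /optensor; case: ifP => _; rewrite /= ?mulr0 // !mulrA.
  rewrite exchange_big [RHS]exchange_big; apply: eq_bigr => s _ /=.
  rewrite exchange_big; apply: eq_bigr => q1 _ /=.
  rewrite mulr_suml; apply: eq_bigr => p1 _; by rewrite -mulr_sumr.
have sqE (f : I * J -> C) : sqnorm F f =
    \sum_(i <- F1) \sum_(s <- F2) `|ext f (i, s)| ^+ 2.
  rewrite /sqnorm extE; apply: eq_bigr => i _; apply: eq_bigr => s _.
  by rewrite /ext; case: ifP => // _; rewrite normr0 expr0n.
have zetaB : \sum_(q1 <- F1) \sum_(s <- F2) `|zeta q1 s| ^+ 2 <=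
    (K ^+ 2)%:C * sqnorm F eta.
  rewrite sqE exchange_big [X in _ <= _ * X]exchange_big mulr_sumr.
  by apply: ler_sum => s _; apply: opnorm_col_sq.
have thetaB : \sum_(q1 <- F1) \sum_(s <- F2) `|theta q1 s| ^+ 2 <=
    (L ^+ 2)%:C * sqnorm F xi.
  rewrite sqE mulr_sumr; apply: ler_sum => q1 _.
  have := opnorm_col_sq F2 (fun s => ext xi (q1, s)) L0 (opnorm_tr SL).
  congr (_ <= _); apply: eq_bigr => s _; rewrite /theta.
  by under eq_bigr do rewrite mulrC.
rewrite (le_trans (ler_norm_sum _ _ _)) //.
(* AM-GM weighted by L / K, so that both halves get the same constant. *)
apply: (@le_trans _ _ (\sum_(q1 <- F1) \sum_(s <- F2)
  (L%:C / K%:C / 2 * `|zeta q1 s| ^+ 2 + K%:C / L%:C / 2 * `|theta q1 s| ^+ 2))).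
  apply: ler_sum => q1 _; rewrite (le_trans (ler_norm_sum _ _ _)) //.
  apply: ler_sum => s _; rewrite normrM -subr_ge0.
  have -> : L%:C / K%:C / 2 * `|zeta q1 s| ^+ 2 + K%:C / L%:C / 2 * `|theta q1 s| ^+ 2
    - `|zeta q1 s| * `|theta q1 s| =
    (L%:C * `|zeta q1 s| - K%:C * `|theta q1 s|) ^+ 2 / (2 * K%:C * L%:C).
    by field; rewrite !gt_eqF.
  apply: divr_ge0; last by apply: mulr_ge0; [apply: mulr_ge0 => //|]; apply: ltW.
  by rewrite real_exprn_even_ge0 // rpredB // rpredM // ger0_real // ltW.
under eq_bigr do rewrite big_split /= -!mulr_sumr.
rewrite big_split /= -!mulr_sumr.
apply: (@le_trans _ _ (L%:C / K%:C / 2 * ((K ^+ 2)%:C * sqnorm F eta) +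
   K%:C / L%:C / 2 * ((L ^+ 2)%:C * sqnorm F xi))).
  by apply: lerD; rewrite ler_wpM2l // !divr_ge0 // ltW.
rewrite !rmorphXn rmorphM /= le_eqVlt; apply/orP; left; apply/eqP.
by field; rewrite !gt_eqF.
Qed.

End OperatorNorm2.

(** * Norm closures and products of operators *)

Section Closure.
Variable R : realType.
Local Notation C := (R[i]).
Local Notation "x %:C" := (real_complex R x) : ring_scope.

Lemma normC_real (z : C) : exists2 r : R, 0 <= r & `|z| = r%:C.
Proof.
have /complex_realP[r E] := normr_real z.
by exists r => //; rewrite -ler0c -E.
Qed.

Lemma eq0_of_small (z : C) : (forall e : R, 0 < e -> `|z| <= e%:C) -> z = 0.
Proof.
move=> h; apply/eqP; rewrite -normr_eq0; have [r r0 zr] := normC_real z.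
move: zr; have [-> -> //|rn0 zr] := eqVneq r 0.
have rp : 0 < r by rewrite lt_def rn0.
have := h (r / 2); rewrite zr lecR divr_gt0 // => /(_ isT); lra.
Qed.

Section OneSpace.
Variable I : choiceType.
Implicit Types (T S U : opmatrix R I) (A B : set (opmatrix R I)).

Lemma opsub_trans S T U : opsub T U = opadd (opsub T S) (opsub S U).
Proof.
by apply/funext => i; apply/funext => j; rewrite /opsub /opadd addrA subrK.
Qed.

Lemma opnorm_sub_trans S T U e f : opnorm_le e (opsub T S) ->
  opnorm_le f (opsub S U) -> opnorm_le (e + f) (opsub T U).
Proof. by move=> h1 h2; rewrite (opsub_trans S); apply: opnormD. Qed.

Lemma opnorm_subC T S e : opnorm_le e (opsub T S) -> opnorm_le e (opsub S T).
Proof.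
move=> h; have -> : opsub S T = opscale (-1) (opsub T S).
  by apply/funext => i; apply/funext => j; rewrite /opsub /opscale; ring.
by rewrite -[e]mul1r; apply: opnormZ h; rewrite normrN1.
Qed.

Lemma sub_opclosure A : A `<=` opclosure A.
Proof. by move=> T AT e e0; exists T => //; apply/opnorm_sub_self/ltW. Qed.

Lemma opclosureS A B : A `<=` opclosure B -> opclosure A `<=` opclosure B.
Proof.
move=> AB T AT e e0; have e20 : 0 < e / 2 by rewrite divr_gt0.
have [S AS TS] := AT _ e20; have [U BU SU] := AB S AS _ e20.
by exists U => //; rewrite (splitr e); apply: opnorm_sub_trans TS SU.
Qed.

Definition opsubspace A : Prop :=
  [/\ A (@opzero R I), forall T S, A T -> A S -> A (opadd T S) &
      forall z T, A T -> A (opscale z T)].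

Lemma opsub_opadd T S : opsub T S = opadd T (opscale (-1) S).
Proof.
by apply/funext => i; apply/funext => j; rewrite /opsub /opadd /opscale mulN1r.
Qed.

Lemma opsubspace_sub A T S : opsubspace A -> A T -> A S -> A (opsub T S).
Proof. by move=> [_ AD AZ] AT AS; rewrite opsub_opadd; apply: AD => //; apply: AZ. Qed.

Lemma opsubspace_sum A (Q : eqType) (s : seq Q) (f : Q -> opmatrix R I) :
  opsubspace A -> (forall q, q \in s -> A (f q)) ->
  A (fun i j => \sum_(q <- s) f q i j).
Proof.
move=> [A0 AD AZ]; elim: s => [|q s IH] fA.
  by rewrite (_ : (fun i j => _) = @opzero R I) //; apply/funext => i;
     apply/funext => j; rewrite big_nil.
rewrite (_ : (fun i j => _) = opadd (f q) (fun i j => \sum_(q <- s) f q i j)).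
  apply: AD; first by apply: fA; rewrite mem_head.
  by apply: IH => r rs; apply: fA; rewrite in_cons rs orbT.
by apply/funext => i; apply/funext => j; rewrite big_cons.
Qed.

Lemma opsubspace_closure A : opsubspace A -> opsubspace (opclosure A).
Proof.
move=> [A0 AD AZ]; split; first exact: sub_opclosure.
  move=> T S AT AS e e0; have e20 : 0 < e / 2 by rewrite divr_gt0.
  have [T' AT' h] := AT _ e20; have [S' AS' h'] := AS _ e20.
  exists (opadd T' S'); first exact: AD.
  rewrite (_ : opsub _ _ = opadd (opsub T T') (opsub S S')).
    by rewrite (splitr e); apply: opnormD.
  by apply/funext => i; apply/funext => j; rewrite /opsub /opadd; ring.
move=> z T AT e e0.
have [r r0 zr] : exists2 r : R, 0 < r & `|z| <= r%:C.
  have [r r0 zr] := normC_real z; exists (r + 1); first exact: ltr_wpDl.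
  by rewrite zr lecR lerDl.
have [T' AT' h] := AT (e / r) (divr_gt0 e0 r0).
exists (opscale z T'); first exact: AZ.
rewrite (_ : opsub _ _ = opscale z (opsub T T')).
  by rewrite -(@divfK _ r _ e) ?gt_eqF // [e / r * r]mulrC; apply: opnormZ.
by apply/funext => i; apply/funext => j; rewrite /opsub /opscale; ring.
Qed.

Lemma opsubspace_span A : opsubspace (opspan A).
Proof.
split.
- exists 0%N, (fun=> 0), (fun=> @opzero R I); split; first by case.
  by apply/funext => i; apply/funext => j; rewrite big_ord0.
- move=> _ _ [n [z [S [AS ->]]]] [m [w [U [AU ->]]]].
  exists (n + m)%N, (fun k => match fintype.split k with inl a => z a | inr b => w b end),
    (fun k => match fintype.split k with inl a => S a | inr b => U b end).
  split; first by move=> k; case: fintype.split.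
  apply/funext => i; apply/funext => j; rewrite /opadd big_split_ord /=.
  congr (_ + _); apply: eq_bigr => k _.
    by rewrite (unsplitK (inl k : 'I_n + 'I_m)).
  by rewrite (unsplitK (inr k : 'I_n + 'I_m)).
- move=> z _ [n [w [S [AS ->]]]]; exists n, (fun l => z * w l), S; split => //.
  apply/funext => i; apply/funext => j; rewrite /opscale mulr_sumr.
  by apply: eq_bigr => l _; rewrite mulrA.
Qed.

Lemma sub_opspan A : A `<=` opspan A.
Proof.
move=> T AT; exists 1%N, (fun=> 1), (fun=> T); split=> //.
by apply/funext => i; apply/funext => j; rewrite big_ord1 mul1r.
Qed.

Lemma opspan_min A B : opsubspace B -> A `<=` B -> opspan A `<=` B.
Proof.
move=> BS AB _ [n [z [S [AS ->]]]].
rewrite (_ : (fun i j => _) =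
    fun i j => \sum_(l <- index_enum 'I_n) opscale (z l) (S l) i j) //.
have [_ _ BZ] := BS.
by apply: (opsubspace_sum (f := fun l => opscale (z l) (S l))) => // l _; apply/BZ/AB.
Qed.

End OneSpace.

Section Contraction.
Variables I J : choiceType.

Definition opcontraction (L : opmatrix R I -> opmatrix R J) : Prop :=
  (forall T S, L (opsub T S) = opsub (L T) (L S)) /\
  (forall K T, opnorm_le K T -> opnorm_le K (L T)).

Lemma opclosure_map (L : opmatrix R I -> opmatrix R J) A B : opcontraction L ->
  (forall T, A T -> opclosure B (L T)) ->
  forall T, opclosure A T -> opclosure B (L T).
Proof.
move=> [LB LN] AB T AT e e0; have e20 : 0 < e / 2 by rewrite divr_gt0.
have [S AS TS] := AT _ e20; have [U BU SU] := AB S AS _ e20.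
exists U => //; rewrite (splitr e); apply: (opnorm_sub_trans _ SU).
by rewrite -LB; apply: LN.
Qed.
End Contraction.

Section Product.

Lemma summability_sumE (I : choiceType) (f : I -> C) :
  summability.sum (R := C^o) f =
  lim ((fun F : {fset I} => \sum_(i <- F) f i : C^o) @ @summability.totally I).
Proof.
rewrite /summability.sum.
suff -> : summability.partial_sum (f : I -> C^o) =
    (fun F : {fset I} => \sum_(i <- F) f i : C^o) by [].
apply/funext => F.
by rewrite /summability.partial_sum big_seq_fsetE.
Qed.

Lemma summability_sum1 (I : choiceType) (f : I -> C) (i0 : I) :
  (forall i, i != i0 -> f i = 0) -> summability.sum (R := C^o) f = f i0.
Proof.
move=> f0; have FF := @summability.totally_filter I.
rewrite summability_sumE; apply: (@cvg_lim C^o); first exact: norm_hausdorff.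
apply: cvg_near_cst; exists [fset i0]%fset => // F /= /fsubsetP iF.
rewrite (bigD1_seq i0) ?iF ?inE //= big1 ?addr0 // => i; exact: f0.
Qed.

(** The two nets of partial sums define the same filter, so their limits agree
  whether or not they converge. *)
Lemma summability_sum_inj (I J : choiceType) (h : I -> J) (f : J -> C) :
  injective h -> (forall j, (forall i, h i != j) -> f j = 0) ->
  summability.sum (R := C^o) f = summability.sum (R := C^o) (f \o h).
Proof.
move=> hI f0; rewrite !summability_sumE; congr (lim _).
have imE (F : {fset I}) : \sum_(i <- F) (f \o h) i = \sum_(j <- [fset h i | i in F]%fset) f j.
  by rewrite big_imfset //= => i i' _ _; apply: hI.
have preE (F : {fset J}) : exists G : {fset I},
    (forall i, h i \in F -> i \in G) /\ (forall i, i \in G -> h i \in F).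
  pose s := pmap (fun j => match pselect (exists i, h i == j) with
     | left e => Some (xchoose e) | right _ => None end) F.
  have sP i : (i \in s) = (h i \in F).
    rewrite mem_pmap; apply/mapP/idP => [[j jF]|iF].
      case: pselect => // e [->]; by rewrite (eqP (xchooseP e)).
    exists (h i) => //; case: pselect => [e|]; last by case; exists i.
    by congr Some; apply: hI; rewrite (eqP (xchooseP e)).
  by exists [fset i in s]%fset; split=> i; rewrite !inE sP.
have sumE (F : {fset J}) (G : {fset I}) : (forall i, h i \in F -> i \in G) ->
   (forall i, i \in G -> h i \in F) -> \sum_(j <- F) f j = \sum_(i <- G) (f \o h) i.
  move=> FG GF; rewrite imE; symmetry; apply: big_fset_incl.
    by apply/fsubsetP => _ /imfsetP[i /= iG ->]; apply: GF.
  move=> j jF jn; apply: f0 => i; apply/eqP => hij; case/negP: jn.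
  by apply/imfsetP; exists i => //=; apply: FG; rewrite hij.
apply/seteqP; split=> A /= [F _ hF].
  have [G [FG GF]] := preE F; exists G => // G' /= /fsubsetP GG'.
  pose F' := (F `|` [fset h i | i in G'])%fset.
  have := hF F' (fsubsetUl _ _); rewrite /= (sumE F' G') // => i.
    by rewrite inE => /orP[/FG/GG' //|/imfsetP[i' /= iG' /hI ->]].
  by move=> iG'; rewrite inE; apply/orP; right; apply: in_imfset.
exists [fset h i | i in F]%fset => // F' /= /fsubsetP FF'.
have [G [FG GF]] := preE F'.
have := hF G; rewrite /= (sumE F' G) //; apply.
by apply/fsubsetP => i iF; apply/FG/FF'/in_imfset.
Qed.

End Product.

End Closure.

(** * The groupoid, its operators and its Fourier coefficients *)

Section Groupoid.
Variables (Gam : groupType) (X : topologicalType) (beta : partial_action Gam X).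
Local Notation G := (groupoid beta).
Implicit Types g h : G.

Lemma groupoid_ext g h : src g = src h -> cocycle g = cocycle h -> g = h.
Proof.
move=> sE cE; have [_ rg] := groupoidP g; have [_ rh] := groupoidP h.
apply: val_inj; rewrite /src /cocycle /rng in sE cE rg rh *.
case: (val g) (val h) sE cE rg rh => [[? ?] ?] [[? ?] ?] /= -> -> -> ->.
by [].
Qed.

Definition gdiv g h : G := gmul g (ginv h).

Lemma gdivP g h : src g = src h ->
  [/\ src (gdiv g h) = rng h, rng (gdiv g h) = rng g &
      cocycle (gdiv g h) = (cocycle g * (cocycle h)^-1)%g].
Proof.
by move=> E; rewrite /gdiv /gmul; case: pselect => // ne; case: ne.
Qed.

Lemma gdiv_gunit g : gdiv g (gunit beta (src g)) = g.
Proof.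
have [|s _ c] := @gdivP g (gunit beta (src g)); first by [].
by apply: groupoid_ext; rewrite ?s ?c //= invg1 mulg1.
Qed.

Lemma arrow_subproof t x : pdom beta t^-1%g x ->
  groupoid_set beta (pact beta t x, t, x).
Proof. by []. Qed.

Definition arrow t x (tx : pdom beta t^-1%g x) : G := mkgroupoid (arrow_subproof tx).

Lemma groupoid_val_cts : continuous (val : G -> X * discrete_topology Gam * X).
Proof. exact: initial_continuous. Qed.

Lemma src_cts : continuous (@src _ _ beta).
Proof. by move=> g; apply: (cvg_comp _ _ (groupoid_val_cts (x := g))); exact: cvg_snd. Qed.

Lemma cocycle_cts : continuous (@cocycle _ _ beta : G -> discrete_topology Gam).
Proof.
move=> g; apply: (@cvg_comp _ _ _ val (fun z : X * discrete_topology Gam * X => z.1.2)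
  _ _ _ (groupoid_val_cts (x := g))).
apply: (@cvg_comp _ _ _ fst (fun z : X * discrete_topology Gam => z.2)).
  exact: cvg_fst.
exact: cvg_snd.
Qed.

Lemma cocycle_near g : \forall h \near g, cocycle h = cocycle g.
Proof.
have := @cocycle_cts g [set cocycle g]; apply; exact: (@discrete_set1 (discrete_topology Gam)).
Qed.

End Groupoid.

Section GroupoidOperators.
Variables (R : realType) (Gam : groupType) (X : topologicalType).
Variable beta : partial_action Gam X.
Local Notation C := (R[i]).
Local Notation G := (groupoid beta).
Local Notation "x %:C" := (real_complex R x) : ring_scope.
Implicit Types (f : G -> C) (a : opmatrix R G) (phi : Gam -> C).

Lemma IndE f g h : src g = src h -> Ind f g h = f (gdiv g h).
Proof. by move=> E; rewrite /Ind; case: asboolP. Qed.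

Lemma Ind_out f g h : src g <> src h -> Ind f g h = 0.
Proof. by move=> E; rewrite /Ind; case: asboolP. Qed.

Lemma coef_Ind f g : coef (Ind f) g = f g.
Proof. by rewrite /coef IndE // gdiv_gunit. Qed.

Lemma coef_le K a g : opnorm_le K a -> `|coef a g| <= K%:C.
Proof. exact: opnorm_entry. Qed.

(** The matrices Ind f are invariant under right translation in the groupoid, and
  this passes to norm limits because entries are norm continuous. *)
Lemma CrE a g h : Cr a -> a g h = if `[< src g = src h >] then coef a (gdiv g h) else 0.
Proof.
move=> aC; apply/eqP; rewrite -subr_eq0; apply/eqP/eq0_of_small => e e0.
have e20 : 0 < e / 2 by rewrite divr_gt0.
have [_ [f fC <-] af] := aC _ e20.
have h1 : `|a g h - Ind f g h| <= (e / 2)%:C := opnorm_entry g h af.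
case: asboolP => sgh.
  have h2 := coef_le (gdiv g h) af.
  rewrite /coef /opsub -!/(coef _ _) coef_Ind -(IndE f sgh) in h2.
  rewrite (splitr e) rmorphD /= -[_ - _](subrKA (Ind f g h)).
  by rewrite (le_trans (ler_normD _ _)) // lerD // distrC.
rewrite Ind_out // in h1; apply: (le_trans h1); rewrite lecR; lra.
Qed.

Lemma Cr_eq a b : Cr a -> Cr b -> (forall g, coef a g = coef b g) -> a = b.
Proof.
move=> aC bC ab; apply/funext => g; apply/funext => h.
by rewrite !CrE // ab.
Qed.

Lemma continuous_cocycle phi : continuous ((fun g => phi (cocycle g)) : G -> C^o).
Proof.
move=> g; apply: (@cvg_near_cst _ C^o _ _ (nbhs g)); apply: filterS (cocycle_near g).
by move=> h ->.
Qed.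

Lemma CcZ f phi : Cc f -> Cc (fun g => phi (cocycle g) * f g).
Proof.
move=> [fc fs]; split.
  move=> g; have phic : (fun h => phi (cocycle h) : C^o) @ (g : G) -->
      (phi (cocycle g) : C^o) := @continuous_cocycle phi g.
  exact: (@cvgM _ _ (nbhs (g : G)) _ _ _ _ _ phic (fc g)).
apply: subclosed_compact fs _; first exact: closed_closure.
apply: closure_subset => g /=; by rewrite mulf_eq0 negb_or => /andP[].
Qed.

Lemma support_ofN f g : ~ support_of f g -> f g = 0.
Proof. by move=> n; apply/eqP/negP => /negP fg; apply/n/subset_closure. Qed.

(** The Schur multiplier with kernel phi (s t^-1); on the functions of operators
  it is multiplication by [phi \o cocycle]. *)
Definition schur phi a : opmatrix R G :=
  fun g h => phi (cocycle g * (cocycle h)^-1)%g * a g h.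

Lemma schur_Ind phi f : schur phi (Ind f) = Ind (fun g => phi (cocycle g) * f g).
Proof.
apply/funext => g; apply/funext => h; rewrite /schur.
case: (pselect (src g = src h)) => E; last by rewrite !Ind_out // mulr0.
by rewrite !IndE //; have [_ _ ->] := gdivP E.
Qed.

Lemma coef_schur phi a g : coef (schur phi a) g = phi (cocycle g) * coef a g.
Proof. by rewrite /coef /schur /= invg1 mulg1. Qed.

Lemma schurB phi a b : schur phi (opsub a b) = opsub (schur phi a) (schur phi b).
Proof. by apply/funext => g; apply/funext => h; rewrite /schur /opsub mulrBr. Qed.

Lemma schur_Cr phi a : opcontraction (schur phi) -> Cr a -> Cr (schur phi a).
Proof.
move=> pc; apply: opclosure_map => // _ [f fC <-].
by apply: sub_opclosure; exists (fun g => phi (cocycle g) * f g); [exact: CcZ | rewrite schur_Ind].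
Qed.

(** Kernels (s, t) |-> phi (s t^-1) that factor, on finite sets, through unit
  balls of finite dimensional Hilbert spaces. *)
Definition contractive_kernel phi : Prop :=
  forall F : {fset Gam}, exists (W : seq Gam) (x y : Gam -> Gam -> C),
     [/\ {in F &, forall s t, phi (s * t^-1)%g = \sum_(w <- W) x w s * y w t},
         {in F, forall s, \sum_(w <- W) `|x w s| ^+ 2 <= 1} &
         {in F, forall s, \sum_(w <- W) `|y w s| ^+ 2 <= 1}].

Lemma schur_contraction phi : contractive_kernel phi -> opcontraction (schur phi).
Proof.
move=> hphi; split; first exact: schurB.
move=> K T TK; apply: (@opnorm_pull _ _ _ Gam _ _ _ TK) => F.
have [W [x [y [phiE x1 y1]]]] := hphi [fset cocycle g | g in F]%fset.
exists W, (fun w g => x w (cocycle g)), (fun w g => y w (cocycle g)),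
  (fun _ g => g), (fun _ g => g); split.
- move=> g h gF hF; rewrite /schur phiE ?in_imfset // mulr_suml.
  by apply: eq_bigr => w _; ring.
- by move=> w g h _ _ _ _ gh; exact: gh.
- by move=> w g h _ _ _ _ gh; exact: gh.
- by move=> g gF; apply/x1/in_imfset.
- by move=> g gF; apply/y1/in_imfset.
Qed.

(** The kernel of the point mass at t is [s = t r], the matrix of lambda_t. *)
Definition fourier t a : opmatrix R G := schur (fun s => (s == t)%:R) a.

Lemma sum_pred1 (Q : eqType) (s : seq Q) (q : Q) : uniq s -> q \in s ->
  \sum_(w <- s) (w == q)%:R = 1 :> C.
Proof.
move=> us qs; rewrite (bigD1_seq q) //= eqxx big1 ?addr0 // => w.
by move=> /negPf ->.
Qed.

Lemma fourier_contraction t : opcontraction (fourier t).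
Proof.
apply: schur_contraction => F.
exists (undup (F ++ [seq (t^-1 * s)%g | s <- F])), (fun w s => (w == t^-1 * s)%g%:R),
  (fun w s => (w == s)%:R).
have sq (b : bool) : `|b%:R : C| ^+ 2 = b%:R.
  by case: b; rewrite ?normr1 ?normr0 ?expr1n ?expr0n.
split=> [s r sF rF|s sF|s sF].
- rewrite (bigD1_seq r) ?undup_uniq ?mem_undup ?mem_cat ?rF //= eqxx mulr1.
  rewrite big1 ?addr0 => [|w /negPf ->]; last by rewrite mulr0.
  congr (nat_of_bool _)%:R; apply/eqP/eqP => [<-|->]; last first.
    by apply: (mulIg (t^-1 * s)%g); rewrite mulgVK mulVKg.
  by rewrite invgF mulgVK.
- under eq_bigr do rewrite sq; rewrite sum_pred1 ?undup_uniq ?mem_undup ?mem_cat //.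
  by apply/orP; right; apply/mapP; exists s.
- by under eq_bigr do rewrite sq; rewrite sum_pred1 ?undup_uniq ?mem_undup ?mem_cat ?sF.
Qed.

Lemma character_contraction (chi : Gam -> C) : group_character chi ->
  opcontraction (schur chi).
Proof.
move=> [chiM chi1]; apply: schur_contraction => F.
exists [:: 1%g], (fun _ s => chi s), (fun _ s => chi (s^-1)%g).
by split=> [s t _ _|s _|s _]; rewrite big_seq1 // ?chiM // chi1 expr1n.
Qed.

Lemma coef_fourier t a g : coef (fourier t a) g = if cocycle g == t then coef a g else 0.
Proof. by rewrite coef_schur; case: eqP => _; rewrite ?mul1r ?mul0r. Qed.

Lemma fourier_Cr t a : Cr a -> Cr (fourier t a).
Proof. exact/schur_Cr/fourier_contraction. Qed.

(** A fibre of the cocycle is a bisection, so an operator carried by it is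
  monomial. *)
Lemma fibre_norm K t a : 0 <= K -> Cr a -> (forall g, cocycle g <> t -> coef a g = 0) ->
  (forall g, `|coef a g| <= K%:C) -> opnorm_le K a.
Proof.
move=> K0 aC at0 aK.
have supp g h : a g h != 0 -> src g = src h /\ cocycle g = (t * cocycle h)%g.
  rewrite CrE //; case: asboolP => [E|_]; last by rewrite eqxx.
  have [_ _ c] := gdivP E; have [ct|nt] := eqVneq (cocycle (gdiv g h)) t; last first.
    by rewrite at0 ?eqxx //; apply/eqP.
  by move=> _; split=> //; rewrite -ct c mulgVK.
apply: opnorm_monomial => // [g h|g h h'|g g' h].
- by rewrite CrE //; case: asboolP => _ //; rewrite normr0 ler0c.
- move=> /supp[s1 c1] /supp[s2 c2]; apply: groupoid_ext; first by rewrite -s1.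
  by apply: (mulgI t); rewrite -c1.
- by move=> /supp[s1 c1] /supp[s2 c2]; apply: groupoid_ext; rewrite ?s1 ?s2 ?c1 ?c2.
Qed.

End GroupoidOperators.

(** * Hahn-Banach separation and Day's argument *)

Section Separation.
Variables (R : realType) (V : lmodType R) (D : set V).
Hypothesis D0 : D 0.
Hypothesis DD : forall v w, D v -> D w -> D (v + w).
Hypothesis DZ : forall (c : R) v, D v -> D (c *: v).
Implicit Types (p q : V -> R) (v w : V).

Let DN v : D v -> D (- v).
Proof. by rewrite -scaleN1r; exact: DZ. Qed.

Definition sublinear_on p : Prop :=
  (forall v w, D v -> D w -> p (v + w) <= p v + p w) /\
  (forall c v, 0 < c -> D v -> p (c *: v) <= c * p v).

Lemma sublinearZ p c v : sublinear_on p -> 0 < c -> D v -> p (c *: v) = c * p v.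
Proof.
move=> [_ pZ] c0 Dv; apply/eqP; rewrite eq_le pZ //= mulrC -ler_pdivlMr // mulrC.
by have := pZ c^-1 _ _ (DZ c Dv); rewrite invr_gt0 scalerA mulVf ?gt_eqF // scale1r; apply.
Qed.

Lemma sublinear0 p : sublinear_on p -> p 0 = 0.
Proof. by move=> hp; have := sublinearZ hp (ltr0n _ 2) D0; rewrite scaler0; lra. Qed.

Lemma sublinearN p v : sublinear_on p -> D v -> - p (- v) <= p v.
Proof.
move=> hp Dv; have [pD _] := hp; have := pD v (- v) Dv (DN Dv).
rewrite subrr (sublinear0 hp); lra.
Qed.

(** The three sublinear functionals of the separation argument (the gauge of a
  cone, the lower bound of a chain and the directional derivative) are infima
  of this kind. *)
Lemma inf_sublinear (Phi : set (V -> R)) (b : V -> R) :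
  Phi !=set0 -> (forall f v, Phi f -> D v -> b v <= f v) ->
  (forall f g v w, Phi f -> Phi g -> D v -> D w ->
     exists2 h, Phi h & h (v + w) <= f v + g w) ->
  (forall f c v, Phi f -> 0 < c -> D v -> exists2 h, Phi h & h (c *: v) <= c * f v) ->
  sublinear_on (fun v => inf [set f v | f in Phi]) /\
  forall f v, Phi f -> D v -> inf [set f v | f in Phi] <= f v.
Proof.
move=> [f0 Pf0] Pb PD PZ; set q := fun v => _.
have qle f v : Phi f -> D v -> q v <= f v.
  move=> Pf Dv; apply: ge_inf; last by exists f.
  by exists (b v) => _ [g Pg <-]; apply: Pb.
have qge x v : D v -> (forall f, Phi f -> x <= f v) -> x <= q v.
  move=> Dv xf; apply: lb_le_inf; first by exists (f0 v), f0.
  by move=> _ [f Pf <-]; apply: xf.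
split=> //; split=> [v w Dv Dw|c v c0 Dv].
  rewrite -lerBlDr; apply: (qge _ v) => // f Pf; rewrite lerBlDl -lerBlDr.
  apply: (qge _ w) => // g Pg; rewrite lerBlDl.
  have [h Ph] := PD f g v w Pf Pg Dv Dw; apply: le_trans; apply: qle => //.
  exact: DD.
rewrite mulrC -ler_pdivrMr //; apply: qge => // f Pf; rewrite ler_pdivrMr // mulrC.
have [h Ph] := PZ f c v Pf c0 Dv; apply: le_trans; apply: qle => //; exact: DZ.
Qed.

(** Hahn-Banach: a minimal sublinear functional is linear, because the
  directional derivative p' (v) = inf_(l >= 0) p (v + l y) - l p (y) is again
  sublinear and below p, with p' (- y) <= - p (y). *)
Lemma hahn_banach q : sublinear_on q -> exists f : V -> R,
  [/\ forall v w, D v -> D w -> f (v + w) = f v + f w,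
      forall c v, D v -> f (c *: v) = c * f v &
      forall v, D v -> f v <= q v].
Proof.
move=> hq.
pose T := {p : V -> R | sublinear_on p /\ forall v, D v -> p v <= q v}.
pose rel (s t : T) := `[< forall v, D v -> sval t v <= sval s v >].
pose mkT p (hp : sublinear_on p) (pq : forall v, D v -> p v <= q v) : T :=
  exist _ p (conj hp pq).
pose t0 := mkT q hq (fun v _ => lexx (q v)).
have [|||[p [hp pq]] pmin] := @ZL_preorder T t0 rel.
- by move=> t; apply/asboolP => v _.
- move=> r s t /asboolP rs /asboolP st; apply/asboolP => v Dv.
  exact: le_trans (st v Dv) (rs v Dv).
- move=> A tot; case: (pselect (A !=set0)) => [[s0 As0]|A0]; last first.
    by exists t0 => s As; case: A0; exists s.
  have [|||| rsub rle] := @inf_sublinear [set sval s | s in A] (fun v => - q (- v)).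
  + by exists (sval s0), s0.
  + move=> _ v [s As <-] Dv; have [hs sq] := svalP s.
    apply: le_trans (sublinearN hs Dv); rewrite lerN2; exact/sq/DN.
  + move=> _ _ v w [s As <-] [t At <-] Dv Dw.
    have [[sD _] _] := svalP s; have [[tD _] _] := svalP t.
    have [/asboolP st|/asboolP ts] := tot s t As At.
      exists (sval t); first by exists t.
      by apply: (le_trans (tD _ _ Dv Dw)); rewrite lerD2r st.
    exists (sval s); first by exists s.
    by apply: (le_trans (sD _ _ Dv Dw)); rewrite lerD2l ts.
  + move=> _ c v [s As <-] c0 Dv; have [[_ sZ] _] := svalP s.
    by exists (sval s); [exists s | exact: sZ].
  have rq v : D v -> inf [set f v | f in [set sval s | s in A]] <= q v.
    move=> Dv; have [_ sq] := svalP s0; apply: le_trans (sq v Dv).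
    by apply: rle => //; exists s0.
  exists (mkT _ rsub rq) => s As; apply/asboolP => v Dv /=.
  by apply: rle => //; exists s.
have pN y : D y -> p (- y) = - p y.
  move=> Dy; apply/eqP; rewrite eq_le; apply/andP; split; last first.
    by rewrite lerNl; exact: sublinearN.
  have [pD pZ] := hp.
  pose Phi := [set (fun v => p (v + l *: y) - l * p y) | l in [set l | 0 <= l]].
  have plZ l : 0 <= l -> p (l *: y) = l * p y.
    rewrite le_eqVlt => /predU1P[<-|l0]; last exact: sublinearZ.
    by rewrite scale0r mul0r sublinear0.
  have [||||rsub rle] := @inf_sublinear Phi (fun v => - p (- v)).
  - by exists (fun v => p (v + 0 *: y) - 0 * p y), 0 => /=.
  - move=> _ v [l l0 <-] Dv; rewrite lerBrDr addrC -plZ // lerBlDr.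
    have := pD (v + l *: y) (- v); rewrite addrAC subrr add0r.
    by apply; [apply: DD => //; apply: DZ | apply: DN].
  - move=> _ _ v w [l l0 <-] [k k0 <-] Dv Dw.
    exists (fun v => p (v + (l + k) *: y) - (l + k) * p y).
      by exists (l + k) => //=; apply: addr_ge0.
    rewrite scalerDl addrACA; have := pD (v + l *: y) (w + k *: y).
    move=> /(_ (DD Dv (DZ l Dy)) (DD Dw (DZ k Dy))); lra.
  - move=> _ c v [l l0 <-] c0 Dv.
    exists (fun v => p (v + (c * l) *: y) - (c * l) * p y).
      by exists (c * l) => //=; apply: mulr_ge0 => //; apply: ltW.
    rewrite -scalerA -scalerDr mulrBr -mulrA lerD2r.
    by apply: pZ => //; apply: DD => //; apply: DZ.
  have rp v : D v -> inf [set f v | f in Phi] <= p v.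
    move=> Dv; have := rle _ v (ex_intro2 _ _ 0 (lexx 0) erefl) Dv.
    by rewrite scale0r addr0 mul0r subr0.
  have rq v : D v -> inf [set f v | f in Phi] <= q v.
    by move=> Dv; apply: le_trans (pq v Dv); apply: rp.
  have /asboolP/(_ (- y) (DN Dy)) /= := pmin (mkT _ rsub rq) (introT (asboolP _) rp).
  move=> h; apply: (le_trans h).
  have := rle _ (- y) (ex_intro2 _ _ 1 ler01 erefl) (DN Dy).
  by rewrite scale1r addNr (sublinear0 hp) mul1r sub0r.
have padd v w : D v -> D w -> p (v + w) = p v + p w.
  move=> Dv Dw; have [pD _] := hp; apply/eqP; rewrite eq_le pD //=.
  have := pD (v + w) (- w) (DD Dv Dw) (DN Dw); rewrite addrK pN //; lra.
exists p; split=> // c v Dv; have [c0|c0|->] := ltgtP c 0.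
- rewrite -[c]opprK scaleNr pN; last exact: DZ.
  by rewrite (sublinearZ hp) ?oppr_gt0 // !mulNr.
- exact: sublinearZ.
- by rewrite scale0r mul0r sublinear0.
Qed.

(** Apply Hahn-Banach to the gauge v |-> inf_s N (v + comb s) - e mass s of the
  cone: it is at most N, and at most - e at each - d t. *)
Lemma cone_separation (N : V -> R) (T : Type) (d : T -> V) (e : R) :
  (forall v w, D v -> D w -> N (v + w) <= N v + N w) ->
  (forall c v, D v -> N (c *: v) = `|c| * N v) ->
  (forall t, D (d t)) ->
  (forall s : seq (R * T), all (fun x => 0 <= x.1) s ->
     e * \sum_(x <- s) x.1 <= N (\sum_(x <- s) x.1 *: d x.2)) ->
  exists f : V -> R,
  [/\ forall v w, D v -> D w -> f (v + w) = f v + f w,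
      forall c v, D v -> f (c *: v) = c * f v,
      forall v, D v -> `|f v| <= N v &
      forall t, e <= f (d t)].
Proof.
move=> ND NZ Dd dist.
pose comb (s : seq (R * T)) := \sum_(x <- s) x.1 *: d x.2.
pose mass (s : seq (R * T)) := \sum_(x <- s) x.1.
have Dcomb s : D (comb s).
  elim: s => [|x s IH]; first by rewrite /comb big_nil.
  by rewrite /comb big_cons; apply: DD => //; apply: DZ.
pose Phi := [set (fun v => N (v + comb s) - e * mass s) |
              s in [set s | all (fun x => 0 <= x.1) s]].
have [||||qsub qle] := @inf_sublinear Phi (fun v => - N v).
- by exists (fun v => N (v + comb [::]) - e * mass [::]), [::].
- move=> _ v [s s0 <-] Dv; have := dist s s0; rewrite -/(comb s) -/(mass s).
  have := ND (v + comb s) (-1 *: v) (DD Dv (Dcomb s)) (DZ _ Dv).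
  rewrite NZ // scaleN1r addrAC subrr add0r normrN1; lra.
- move=> _ _ v w [s s0 <-] [r r0 <-] Dv Dw.
  exists (fun v => N (v + comb (s ++ r)) - e * mass (s ++ r)).
    by exists (s ++ r) => //=; rewrite all_cat s0.
  rewrite /comb /mass !big_cat /= addrACA.
  have := ND (v + comb s) (w + comb r) (DD Dv (Dcomb s)) (DD Dw (Dcomb r)).
  rewrite /comb /mass; lra.
- move=> _ c v [s s0 <-] c0 Dv; pose cs := [seq (c * x.1, x.2) | x <- s].
  exists (fun v => N (v + comb cs) - e * mass cs).
    exists cs => //=; rewrite all_map; apply: sub_all s0 => x /= x0.
    by apply: mulr_ge0 => //; apply: ltW.
  have -> : comb cs = c *: comb s.
    by rewrite /comb big_map scaler_sumr; apply: eq_bigr => x _; rewrite scalerA.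
  have -> : mass cs = c * mass s by rewrite /mass big_map mulr_sumr.
  rewrite -scalerDr NZ ?(gtr0_norm c0); last exact: DD.
  by rewrite mulrBr lerD2l lerN2 mulrCA.
have [f [fD fZ fq]] := hahn_banach qsub.
have fN v : D v -> f v <= N v.
  move=> Dv; apply: (le_trans (fq v Dv)).
  have := qle _ v (ex_intro2 _ _ [::] isT erefl) Dv.
  by rewrite /comb /mass !big_nil addr0 mulr0 subr0.
exists f; split=> // [v Dv|t].
  rewrite ler_norml fN // andbT lerNl -mulN1r -fZ // (le_trans (fN _ _)) //.
    exact: DZ.
  by rewrite NZ // normrN1 mul1r.
have := fq (- d t) (DN (Dd t)); rewrite -scaleN1r fZ // mulN1r => h.
have all1 : all (fun x : R * T => 0 <= x.1) [:: (1, t)] by rewrite /= ler01.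
have := qle _ (- d t) (ex_intro2 _ _ [:: (1, t)] all1 erefl) (DN (Dd t)).
rewrite /comb /mass !big_seq1 /= scale1r addNr mulr1.
have -> : N 0 = 0 by have := NZ 0 0 D0; rewrite scaler0 normr0 mul0r.
rewrite sub0r => h2; rewrite -lerN2; apply: (le_trans h); rewrite scaleN1r; exact: h2.
Qed.

End Separation.

Section Day.
Variables (R : realType) (Gam : groupType).

Section L1.
Variable J : choiceType.
Local Notation V := (J -> R^o).
(** The space l^1 (J) is the set where the supremum of the finite sums of |v j|,
  its norm, is finite. *)
Definition l1_sums (v : V) : set R := [set \sum_(j <- F) `|v j| | F in [set: {fset J}]].
Definition l1 : set V := [set v | has_ubound (l1_sums v)].
Definition l1norm (v : V) : R := sup (l1_sums v).

Lemma l1norm_ge v (F : {fset J}) : l1 v -> \sum_(j <- F) `|v j| <= l1norm v.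
Proof. by move=> vl; apply: ub_le_sup => //; exists F. Qed.

Lemma l1norm_le v (B : R) : (forall F : {fset J}, \sum_(j <- F) `|v j| <= B) ->
  l1 v /\ l1norm v <= B.
Proof.
move=> h; split; first by exists B => _ [F _ <-].
by apply: ge_sup => [|_ [F _ <-]] //; exists (\sum_(j <- fset0) `|v j|), fset0.
Qed.

Lemma l1D v w : l1 v -> l1 w -> l1 (v + w) /\ l1norm (v + w) <= l1norm v + l1norm w.
Proof.
move=> vl wl; apply: l1norm_le => F.
apply: le_trans (lerD (l1norm_ge F vl) (l1norm_ge F wl)).
by rewrite -big_split; apply: ler_sum => j _; apply: ler_normD.
Qed.

Lemma l1Z (c : R) v : l1 v -> l1 (c *: v) /\ l1norm (c *: v) <= `|c| * l1norm v.
Proof.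
move=> vl; apply: l1norm_le => F.
have -> : \sum_(j <- F) `|(c *: v) j| = `|c| * \sum_(j <- F) `|v j|.
  by rewrite mulr_sumr; apply: eq_bigr => j _; rewrite -normrM.
by rewrite ler_wpM2l //; exact: l1norm_ge.
Qed.

Lemma l1normZ (c : R) v : l1 v -> l1norm (c *: v) = `|c| * l1norm v.
Proof.
move=> vl; have [cvl le1] := l1Z c vl; apply/eqP; rewrite eq_le le1 /=.
have [->|cn0] := eqVneq c 0.
  by rewrite normr0 mul0r; apply: le_trans (l1norm_ge fset0 (l1Z 0 vl).1); rewrite big_nil.
have [_] := l1Z c^-1 cvl; rewrite scalerA mulVf // scale1r normfV.
by rewrite mulrC ler_pdivlMr ?normr_gt0 // mulrC.
Qed.

Definition l1delta (i : J) : V := fun j => (j == i)%:R.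

Lemma l1deltaP i : l1 (l1delta i) /\ l1norm (l1delta i) <= 1.
Proof.
apply: l1norm_le => F; have [iF|iF] := boolP (i \in F).
  rewrite (bigD1_seq i) //= /l1delta eqxx normr1 big1 ?addr0 // => j /negPf ->.
  by rewrite normr0.
rewrite big1_seq // => j /= jF; rewrite /l1delta; case: eqP => [E|_]; last by rewrite normr0.
by rewrite -E jF in iF.
Qed.
End L1.

Lemma invariant_mean_sum (m : (Gam -> R) -> R) (Q : Type) (s : seq Q)
    (f : Q -> Gam -> R) : invariant_mean m -> (forall q, bounded_real_fun (f q)) ->
  bounded_real_fun (fun t => \sum_(q <- s) f q t) /\
  m (fun t => \sum_(q <- s) f q t) = \sum_(q <- s) m (f q).
Proof.
move=> [mD mZ _ _ _] fb; elim: s => [|q s [IHb IH]].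
  have b0 : bounded_real_fun (fun _ : Gam => 0 : R) by exists 0 => t; rewrite normr0.
  have E : (fun t => \sum_(q <- [::]) f q t) = (fun _ : Gam => 0 : R).
    by apply/funext => t; rewrite big_nil.
  rewrite E big_nil; split=> //; apply: etrans _ (etrans (mZ 0 _ b0) (mul0r _)).
  by congr m; apply/funext => t; rewrite mul0r.
have E : (fun t => \sum_(q <- q :: s) f q t) = (fun t => f q t + \sum_(q <- s) f q t).
  by apply/funext => t; rewrite big_cons.
rewrite E big_cons -IH -mD //; split=> //.
have [K fK] := fb q; have [L fL] := IHb.
by exists (K + L) => t; rewrite (le_trans (ler_normD _ _)) // lerD.
Qed.

Definition weight (s : seq (R * Gam)) (t : Gam) : R :=
  \sum_(x <- s) x.1 * (t == x.2)%:R.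

(** Day's argument. If every finitely supported probability were moved by more
  than e by some element of S, a separating functional would give bounded
  functions f_g with sum_g (f_g (g t) - f_g t) >= e for all t, which an
  invariant mean forbids. *)
Lemma reiter (S : seq Gam) (e : R) : amenable_group R Gam -> uniq S -> 0 < e ->
  exists s : seq (R * Gam), [/\ all (fun x => 0 <= x.1) s, \sum_(x <- s) x.1 = 1 &
    forall g (F : {fset Gam}), g \in S ->
      \sum_(t <- F) `|weight s (g^-1 * t)%g - weight s t| <= e].
Proof.
move=> [m mean] uS e0; apply: contrapT => no.
have {}no s : all (fun x => 0 <= x.1) s -> \sum_(x <- s) x.1 = 1 ->
    exists g (F : {fset Gam}), g \in S /\
      e < \sum_(t <- F) `|weight s (g^-1 * t)%g - weight s t|.
  move=> s0 s1; apply: contrapT => no'; apply: no; exists s; split=> // g F gS.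
  by rewrite leNgt; apply/negP => lt; apply: no'; exists g, F.
pose V : Type := (Gam * Gam)%type -> R^o.
pose d (t : Gam) : V := \sum_(g <- S) (l1delta (g, (g * t)%g) - l1delta (g, t)).
have l10 : l1 (0 : V) by exists 0 => _ [F _ <-]; rewrite big1 // => j _; rewrite normr0.
have l1DD (v w : V) : l1 v -> l1 w -> l1 (v + w) by move=> vl wl; have [] := l1D vl wl.
have l1ZZ (c : R) (v : V) : l1 v -> l1 (c *: v) by move=> vl; have [] := l1Z c vl.
have l1B (v w : V) : l1 v -> l1 w -> l1 (v - w).
  by move=> vl wl; apply: l1DD => //; rewrite -scaleN1r; apply: l1ZZ.
have l1d i : l1 (l1delta i : V) by have [] := @l1deltaP (Gam * Gam)%type i.
have dl t : l1 (d t).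
  by rewrite /d; elim: S {uS no d} => [|g S IH]; rewrite ?big_nil ?big_cons //;
     apply: l1DD => //; apply: l1B.
have dB i i' j : (l1delta i - l1delta i' : V) j = (j == i)%:R - (j == i')%:R by [].
have ZE (c : R) (v : V) j : (c *: v) j = c * v j by [].
have dE t g u : d t (g, u) = if g \in S then (u == g * t)%g%:R - (u == t)%:R else 0.
  rewrite /d (@fct_sumE) /=; case: ifP => gS.
    rewrite (bigD1_seq g) //= big1 ?addr0.
      by rewrite dB !xpair_eqE eqxx.
    move=> h hg; rewrite dB !xpair_eqE [g == h]eq_sym (negPf hg) /=.
    by rewrite subrr.
  rewrite big1_seq // => h /= hS; rewrite dB !xpair_eqE.
  by case: eqP => [E|_]; [rewrite E hS in gS | rewrite /= subrr].
have combE s g u : g \in S -> (\sum_(x <- s) x.1 *: d x.2 : V) (g, u) =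
    weight s (g^-1 * u)%g - weight s u.
  move=> gS; rewrite fct_sumE /weight -sumrB; apply: eq_bigr => x _.
  rewrite ZE dE gS mulrBr; congr (_ * _%:R - _).
  by congr nat_of_bool; apply/eqP/eqP => [->|<-]; rewrite ?mulKg ?mulVKg.
have combl s : l1 (\sum_(x <- s) x.1 *: d x.2 : V).
  by elim: s => [|x s IH]; rewrite ?big_nil ?big_cons //; apply: l1DD => //; apply: l1ZZ.
have [|||s s0|f [fD fZ fN fd]] := @cone_separation R V (@l1 _) l10 l1DD l1ZZ
    (@l1norm _) Gam d e.
- by move=> v w vl wl; have [] := l1D vl wl.
- by move=> c v vl; rewrite l1normZ.
- exact: dl.
- set M := \sum_(x <- s) x.1.
  have : 0 <= M by rewrite /M big_seq; apply: sumr_ge0 => x xs; exact: (allP s0).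
  rewrite le_eqVlt => /predU1P[<-|M0].
    by rewrite mulr0; apply: le_trans (l1norm_ge fset0 (combl s)); rewrite big_nil.
  pose s' := [seq (M^-1 * x.1, x.2) | x <- s].
  have [||g [F [gS lt]]] := no s'.
  + rewrite all_map; apply: sub_all s0 => x /= x0.
    by rewrite mulr_ge0 // invr_ge0 ltW.
  + by rewrite big_map /= -mulr_sumr mulVf ?gt_eqF.
  have wE t : weight s' t = M^-1 * weight s t.
    by rewrite /weight big_map mulr_sumr; apply: eq_bigr => x _; rewrite mulrA.
  have : e * M <= \sum_(t <- F) `|weight s (g^-1 * t)%g - weight s t|.
    rewrite -ler_pdivlMr // mulrC mulr_sumr; apply: (le_trans (ltW lt)).
    rewrite le_eqVlt; apply/orP; left; apply/eqP; apply: eq_bigr => t _.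
    by rewrite !wE -mulrBr normrM gtr0_norm // invr_gt0.
  move=> h; apply: (le_trans h); apply: le_trans (l1norm_ge [fset (g, t) | t in F]%fset (combl s)).
  rewrite big_imfset /=; last by move=> t t' _ _ [].
  by rewrite le_eqVlt; apply/orP; left; apply/eqP; apply: eq_bigr => t _; rewrite combE.
pose ff g t := f (l1delta (g, t) : V).
have ffb g : bounded_real_fun (ff g).
  exists 1 => t; apply: (le_trans (fN _ (l1d _))).
  by have [] := @l1deltaP (Gam * Gam)%type (g, t).
have ffb' g : bounded_real_fun (fun t => ff g (g * t)%g).
  by have [K fK] := ffb g; exists K => t.
have [mD mZ mpos m1 minv] := mean.
have fB v w : l1 v -> l1 w -> f (v - w) = f v - f w.
  by move=> vl wl; rewrite -scaleN1r fD ?fZ ?mulN1r //; apply: l1ZZ.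
have fdE t : f (d t) = \sum_(g <- S) (ff g (g * t)%g - ff g t).
  rewrite /d; elim: (S) => [|g S' IH].
    by rewrite !big_nil; have := fZ 0 0 l10; rewrite scaler0 mul0r.
  have l1s : l1 (\sum_(g <- S') (l1delta (g, (g * t)%g) - l1delta (g, t)) : V).
    by elim: (S') => [|h S'' IH']; rewrite ?big_nil ?big_cons //;
       apply: l1DD => //; apply: l1B.
  by rewrite !big_cons fD ?fB ?IH //; apply: l1B.
have mB h k : bounded_real_fun h -> bounded_real_fun k ->
    bounded_real_fun (fun t => h t - k t) /\ m (fun t => h t - k t) = m h - m k.
  move=> hb kb; have kb' : bounded_real_fun (fun t => -1 * k t).
    by have [K kK] := kb; exists K => t; rewrite mulN1r normrN.
  have E : (fun t => h t - k t) = (fun t => h t + -1 * k t).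
    by apply/funext => t; rewrite mulN1r.
  rewrite E mD // mZ // mulN1r; split=> //.
  have [K hK] := hb; have [L kL] := kb'.
  by exists (K + L) => t; rewrite (le_trans (ler_normD _ _)) // lerD.
have [|sb sE] := @invariant_mean_sum m Gam S (fun g t => ff g (g * t)%g - ff g t) mean.
  by move=> g; have [] := mB _ _ (ffb' g) (ffb g).
have s0 : m (fun t => \sum_(g <- S) (ff g (g * t)%g - ff g t)) = 0.
  rewrite sE big1 // => g _; have [_ ->] := mB _ _ (ffb' g) (ffb g).
  by rewrite -[m (ff g)](minv g^-1%g) // invgK subrr.
have b1 : bounded_real_fun (fun _ : Gam => 1 : R) by exists 1 => t; rewrite normr1.
have be : bounded_real_fun (fun _ : Gam => e * 1 : R) by exists e => t; rewrite mulr1 gtr0_norm.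
have [db dE'] := mB _ _ sb be.
have : 0 <= m (fun t => \sum_(g <- S) (ff g (g * t)%g - ff g t) - e * 1).
  by apply: mpos => // t; rewrite mulr1 subr_ge0 -fdE.
rewrite dE' s0 mZ // m1; lra.
Qed.

End Day.

(** * Almost invariant vectors and Fejer summation *)

Section Kernel.
Variables (R : realType) (Gam : groupType).
Local Notation C := (R[i]).
Local Notation "x %:C" := (real_complex R x) : ring_scope.
Implicit Types s : seq (R * Gam).

Lemma weight_ge0 s t : all (fun x => 0 <= x.1) s -> 0 <= weight s t.
Proof.
move=> s0; rewrite /weight big_seq; apply: sumr_ge0 => x xs.
by rewrite mulr_ge0 // (allP s0).
Qed.

Lemma weight_out s t : t \notin [seq x.2 | x <- s] -> weight s t = 0.
Proof.
move=> tn; rewrite /weight big1_seq // => x /= xs.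
case: eqP => [E|_]; last by rewrite mulr0.
by rewrite E map_f in tn.
Qed.

Lemma sum_weight s (L : seq Gam) : all (fun x => 0 <= x.1) s -> uniq L ->
  \sum_(t <- L) weight s t <= \sum_(x <- s) x.1.
Proof.
move=> s0 uL; rewrite exchange_big big_seq [X in _ <= X]big_seq.
apply: ler_sum => x xs /=; rewrite -mulr_sumr ler_piMr ?(allP s0) //.
have [xL|xL] := boolP (x.2 \in L); last first.
  by rewrite big1_seq // => t /= tL; case: eqP => // E; rewrite -E tL in xL.
by rewrite (bigD1_seq x.2) //= eqxx big1 ?addr0 // => t /negPf ->.
Qed.

Lemma sum_weight_eq s (L : seq Gam) : uniq L -> {subset [seq x.2 | x <- s] <= L} ->
  \sum_(t <- L) weight s t = \sum_(x <- s) x.1.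
Proof.
move=> uL sL; rewrite exchange_big; apply: eq_big_seq => x xs /=.
rewrite -mulr_sumr (bigD1_seq x.2) ?sL ?map_f //= eqxx big1 ?addr0 ?mulr1 //.
by move=> t /negPf ->.
Qed.

Lemma sqr_sqrt_sub (a b : R) : 0 <= a -> 0 <= b ->
  (Num.sqrt a - Num.sqrt b) ^+ 2 <= `|a - b|.
Proof.
wlog ab : a b / b <= a.
  move=> h a0 b0; have /orP[ba|ab] := le_total b a; first exact: h.
  by rewrite distrC -sqrrN opprB; apply: h.
move=> a0 b0; have := sqr_sqrtr a0; have := sqr_sqrtr b0.
have := sqrtr_ge0 b; have : Num.sqrt b <= Num.sqrt a by rewrite ler_sqrt.
rewrite ger0_norm ?subr_ge0 //; move: (Num.sqrt a) (Num.sqrt b) => u v; nra.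
Qed.

(** The coefficient phi (g) = <lambda_g xi, xi> of an almost invariant unit
  vector xi, the square root of an almost invariant probability. *)
Lemma almost_invariant_kernel (S : seq Gam) (e : R) : amenable_group R Gam -> 0 < e ->
  exists (phi : Gam -> C) (P : seq Gam),
    [/\ uniq P, forall t, t \notin P -> phi t = 0,
        forall g, g \in S -> `|1 - phi g| <= e%:C & contractive_kernel phi].
Proof.
move=> am e0.
have [s [s0 s1 sS]] := @reiter R Gam (undup [seq g^-1%g | g <- S]) e am (undup_uniq _) e0.
pose P0 := [fset x.2 | x in s]%fset.
pose p := weight s; pose xi t := Num.sqrt (p t).
have p0 t : 0 <= p t := weight_ge0 t s0.
have pout t : t \notin P0 -> p t = 0.
  move=> tn; apply: weight_out; apply: contra tn => /mapP[x xs ->]; exact: in_imfset.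
have xi2 t : xi t ^+ 2 = p t := sqr_sqrtr (p0 t).
have xiout t : t \notin P0 -> xi t = 0 by move=> tn; rewrite /xi pout // sqrtr0.
pose phi g : R := \sum_(w <- P0) xi (g * w)%g * xi w.
have phiE g (F : {fset Gam}) : (P0 `<=` F)%fset ->
    phi g = \sum_(w <- F) xi (g * w)%g * xi w.
  move=> PF; apply: (big_fset_incl _ PF) => w _ wn; by rewrite [xi w]xiout ?mulr0.
exists (fun g => (phi g)%:C), (undup [seq (w * v^-1)%g | w <- P0, v <- P0]).
split; first exact: undup_uniq.
- move=> t; rewrite mem_undup => tn; rewrite [phi t]big1_seq // => w /= wP.
  rewrite xiout ?mul0r //; apply: contra tn => twP; apply/allpairsP.
  by exists ((t * w)%g, w); split => //=; rewrite mulgK.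
- move=> g gS; have -> : 1 - (phi g)%:C = (1 - phi g)%:C by rewrite rmorphB rmorph1.
  pose F := (P0 `|` [fset (g^-1 * w)%g | w in P0])%fset.
  have sum1 : \sum_(w <- F) p w = 1.
    rewrite -s1; apply: sum_weight_eq; first exact: fset_uniq.
    move=> _ /mapP[x xs ->].
    by rewrite inE; apply/orP; left; apply: in_imfset.
  have sumg : \sum_(w <- F) p (g * w)%g = 1.
    rewrite -s1 -(big_map (fun w => g * w)%g xpredT p); apply: sum_weight_eq.
      by rewrite map_inj_uniq ?fset_uniq // => x y /mulgI.
    move=> _ /mapP[x xs ->]; apply/mapP; exists (g^-1 * x.2)%g; last by rewrite mulVKg.
    by rewrite inE; apply/orP; right; apply: in_imfset; apply: in_imfset.
  have phiF : 1 - phi g = (\sum_(w <- F) (xi (g * w)%g - xi w) ^+ 2) / 2.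
    have -> : \sum_(w <- F) (xi (g * w)%g - xi w) ^+ 2 =
        \sum_(w <- F) p (g * w)%g + \sum_(w <- F) p w
        - 2 * \sum_(w <- F) xi (g * w)%g * xi w.
      rewrite mulr_sumr -big_split -sumrB; apply: eq_bigr => w _ /=.
      by rewrite -!xi2; ring.
    rewrite sum1 sumg -phiE ?fsubsetUl //; lra.
  have B : \sum_(w <- F) (xi (g * w)%g - xi w) ^+ 2 <= e.
    have := sS (g^-1)%g F; rewrite mem_undup map_f // invgK => /(_ isT).
    apply: le_trans; apply: ler_sum => w _; exact: sqr_sqrt_sub.
  have B0 : 0 <= \sum_(w <- F) (xi (g * w)%g - xi w) ^+ 2.
    by apply: sumr_ge0 => w _; apply: sqr_ge0.
  rewrite phiF ger0_norm ?ler0c; last lra.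
  by rewrite lecR; lra.
- move=> F; pose W := undup [seq (v^-1 * w)%g | v <- F, w <- P0].
  have sq u : \sum_(w <- W) `|(xi (u * w)%g)%:C| ^+ 2 <= 1.
    under eq_bigr => w _.
      rewrite ger0_norm ?ler0c ?sqrtr_ge0 // -rmorphXn /= xi2.
      over.
    rewrite -rmorph_sum /= -[1]/(1%:C) lecR -s1.
    rewrite -(big_map (fun w => u * w)%g xpredT p); apply: sum_weight => //.
    by rewrite map_inj_uniq ?undup_uniq // => x y /mulgI.
  exists W, (fun w u => (xi (u * w)%g)%:C), (fun w u => (xi (u * w)%g)%:C).
  split=> [u v uF vF|u _|u _] //.
  under eq_bigr do rewrite -rmorphM; rewrite -rmorph_sum /=; congr (_%:C).
  pose G := [fset (v^-1 * w)%g | w in P0]%fset.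
  transitivity (\sum_(w <- G) xi (u * w)%g * xi (v * w)%g).
    rewrite big_imfset /=; last by move=> x y _ _ /mulgI.
    by apply: eq_bigr => w _; rewrite mulVKg mulgA.
  have GW : (G `<=` [fset w in W])%fset.
    apply/fsubsetP => _ /imfsetP[w /= wP ->]; rewrite inE mem_undup.
    by apply/allpairsP; exists (v, w).
  rewrite (big_fset_incl _ GW) /=; last first.
    move=> w _ wG; rewrite [xi (v * w)%g]xiout ?mulr0 //.
    apply: contra wG => vw; apply/imfsetP; exists (v * w)%g => //.
    by rewrite mulKg.
  apply: perm_big; apply: uniq_perm; [exact: fset_uniq | exact: undup_uniq |].
  by move=> w; rewrite inE.
Qed.

End Kernel.

Section Fejer.
Variables (R : realType) (Gam : groupType) (X : topologicalType).
Variable beta : partial_action Gam X.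
Local Notation C := (R[i]).
Local Notation G := (groupoid beta).
Local Notation "x %:C" := (real_complex R x) : ring_scope.
Implicit Types (f : G -> C) (a : opmatrix R G) (phi : Gam -> C).

(** The form of compactness used below: neighbourhoods are given by a relation,
  and the centres of a finite subcover are returned as a sequence. *)
Lemma compact_finite_cover (T : topologicalType) (K : set T) (Q : T -> set T) :
  compact K -> (forall x, K x -> \forall y \near x, Q x y) ->
  exists s : seq T, (forall x, x \in s -> K x) /\
    forall y, K y -> exists2 x, x \in s & Q x y.
Proof.
move=> /compact_near_coveringP cK cov.
have FF := summability.totally_filter (I := T).
have [x Kx|A _ /(_ A (fsubset_refl A)) sub] := cK {fset T} summability.totally
  (fun i y => exists x, [/\ x \in i, K x & Q x y]) _.
  exists (Q x, [set A : {fset T} | x \in A]) => /=.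
    split; first exact: cov.
    by exists [fset x]%fset => // B /= /fsubsetP; apply; rewrite inE.
  by move=> [y A] /= [Qxy xA]; exists x.
exists [seq x <- A | `[< K x >]]; split=> [x|y /sub[x [xA Kx Qxy]]].
  by rewrite mem_filter => /andP[/asboolP].
by exists x => //; rewrite mem_filter xA andbT; apply/asboolP.
Qed.

(** Near each point g of the support the cocycle is constant and |f| is less than
  |f g| + 1; finitely many such neighbourhoods cover the support. *)
Lemma Cc_finite f : Cc f -> exists (S : seq Gam) (K : R),
  [/\ 0 <= K, forall g, cocycle g \notin S -> f g = 0 & forall g, `|f g| <= K%:C].
Proof.
move=> [fc fs].
have nearQ g : support_of f g ->
    \forall h \near g, cocycle h = cocycle g /\ `|f h| < `|f g| + 1.
  move=> _; apply: filterI; first exact: cocycle_near.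
  have := @cvgr_dist_lt C C^o _ (nbhs g) _ f (f g) (fc g) 1 ltr01 => /(_ _).
  apply: filterS => h fh; rewrite -ltrBlDl; apply: le_lt_trans fh.
  by rewrite distrC; apply: lerB_dist.
have [s [_ cov]] := compact_finite_cover fs nearQ.
exists [seq cocycle g | g <- s].
have [K K0 fK] : exists2 K : R, 0 <= K & forall g, g \in s -> `|f g| + 1 <= K%:C.
  elim: s {cov} => [|g s [K K0 IH]]; first by exists 0.
  have [r r0 rE] := normC_real (f g).
  exists (K + (r + 1)); first by rewrite !addr_ge0.
  move=> h; rewrite in_cons => /predU1P[->|/IH hK].
    by rewrite rE !rmorphD rmorph1 lerDr ler0c.
  by apply: (le_trans hK); rewrite lecR; lra.
exists K; split=> // g.
  move=> gS; apply: contrapT => fg; have [|h hs [cgh _]] := cov g.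
    by apply: subset_closure; apply/eqP.
  by case/negP: gS; rewrite cgh map_f.
have [->|fg] := eqVneq (f g) 0; first by rewrite normr0 ler0c.
have [|h /fK hK [_ lt]] := cov g; first exact: subset_closure.
exact/ltW/(lt_le_trans lt).
Qed.

Lemma schur_sum phi (P : seq Gam) a : uniq P ->
  (forall t, t \notin P -> phi t = 0 \/ fourier t a = @opzero R G) ->
  schur phi a = fun g h => \sum_(t <- P) opscale (phi t) (fourier t a) g h.
Proof.
move=> uP out; apply/funext => g; apply/funext => h.
rewrite /opscale /fourier /schur; set u := (_ * _)%g.
have [uin|uout] := boolP (u \in P).
  rewrite (bigD1_seq u) //= eqxx mul1r big1 ?addr0 // => t.
  by rewrite eq_sym => /negPf ->; rewrite mul0r mulr0.
rewrite big1_seq => [|t /= tP].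
  case: (out u uout) => [->|E]; first by rewrite mul0r.
  have := congr1 (fun T : opmatrix R G => T g h) E.
  by rewrite /fourier /schur -/u eqxx mul1r => ->; rewrite mulr0.
by case: eqP => [E|_]; rewrite ?mul0r ?mulr0 //; rewrite E tP in uout.
Qed.

Lemma opnorm_sum (I : choiceType) (Q : eqType) (s : seq Q) (K : Q -> R)
    (T : Q -> opmatrix R I) : (forall q, q \in s -> opnorm_le (K q) (T q)) ->
  opnorm_le (\sum_(q <- s) K q) (fun i j => \sum_(q <- s) T q i j).
Proof.
elim: s => [|q s IH] h.
  rewrite big_nil (_ : (fun i j => _) = @opzero R I); first exact: opnorm0.
  by apply/funext => i; apply/funext => j; rewrite big_nil.
rewrite big_cons (_ : (fun i j => _) = opadd (T q) (fun i j => \sum_(q <- s) T q i j)).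
  apply: opnormD; first by apply: h; rewrite mem_head.
  by apply: IH => r rs; apply: h; rewrite in_cons rs orbT.
by apply/funext => i; apply/funext => j; rewrite big_cons.
Qed.

Lemma Ind_Cr f : Cc f -> Cr (Ind f : opmatrix R G).
Proof. by move=> fC; apply: sub_opclosure; exists f. Qed.

Lemma fourier_Ind0 t f : (forall g, cocycle g = t -> f g = 0) ->
  fourier t (Ind f) = @opzero R G.
Proof.
move=> f0; rewrite /fourier schur_Ind; apply/funext => g; apply/funext => h.
rewrite /Ind; case: asboolP => // _.
by case: eqP => [/f0 ->|_]; rewrite ?mulr0 ?mul0r.
Qed.

(** For f supported in the fibres over S, multiplication by phi is the finite
  sum of the phi t f_t, and each f_t has norm at most sup |f|. *)
Lemma schur_Ind_norm f phi (S : seq Gam) (K d : R) : Cc f -> uniq S -> 0 <= K ->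
  (forall g, cocycle g \notin S -> f g = 0) -> (forall g, `|f g| <= K%:C) ->
  (forall t, t \in S -> `|phi t| <= d%:C) ->
  opnorm_le (\sum_(t <- S) d * K) (schur phi (Ind f)).
Proof.
move=> fC uS K0 fS fK pd; rewrite (@schur_sum _ S) //; last first.
  by move=> t tS; right; apply: fourier_Ind0 => g ct; apply: fS; rewrite ct.
apply: opnorm_sum => t tS; apply: opnormZ; first exact: pd.
apply: (@fibre_norm _ _ _ _ _ t) => //.
- exact/fourier_Cr/Ind_Cr.
- by move=> g ct; rewrite coef_fourier; case: eqP.
- move=> g; rewrite coef_fourier coef_Ind; case: ifP => // _.
  by rewrite normr0 ler0c.
Qed.

Lemma Cr_bounded a : Cr a -> exists2 K : R, 0 < K & opnorm_le K a.
Proof.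
move=> aC; have [_ [f fC <-] af] := aC 1 ltr01.
have [S [K [K0 fS fK]]] := Cc_finite fC.
have : opnorm_le (\sum_(t <- undup S) 1 * K) (schur (fun=> 1) (Ind f : opmatrix R G)).
  apply: schur_Ind_norm => //; rewrite ?undup_uniq //.
    by move=> g; rewrite mem_undup; apply: fS.
  by move=> t _; rewrite normr1.
have -> : schur (fun=> 1) (Ind f : opmatrix R G) = Ind f.
  by apply/funext => g; apply/funext => h; rewrite /schur mul1r.
move=> fL; exists (1 + \sum_(t <- undup S) 1 * K).
  by rewrite ltr_pwDl //; case: fL.
have -> : a = opadd (opsub a (Ind f)) (Ind f).
  by apply/funext => g; apply/funext => h; rewrite /opadd /opsub subrK.
exact: opnormD.
Qed.

Lemma sum_const_le (S : seq Gam) (e K : R) : 0 <= e -> 0 <= K ->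
  \sum_(t <- S) e / ((size S)%:R + 1) / (K + 1) * K <= e.
Proof.
move=> e0 K0; set n := _%:R + 1; have n0 : 0 < n by rewrite ltr_wpDl.
have K10 : 0 < K + 1 by rewrite ltr_wpDl.
rewrite big_const_seq count_predT iter_addr_0 -[leLHS]mulr_natr.
have -> : e / n / (K + 1) * K * (size S)%:R = e * (K / (K + 1)) * ((size S)%:R / n).
  by field; rewrite ?gt_eqF.
have KK : K / (K + 1) <= 1 by rewrite ler_pdivrMr // mul1r lerDl.
have SS : (size S)%:R / n <= 1 by rewrite ler_pdivrMr // mul1r lerDl.
rewrite -mulrA ler_piMr // mulr_ile1 //; by rewrite divr_ge0 // ltW.
Qed.

(** Fejer summation. Since [schur phi] is a contraction, it is enough to compare f
  with phi f for f in C_c, and f has finitely many Fourier coefficients. *)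
Lemma fejer a : amenable_group R Gam -> Cr a ->
  opclosure (opspan [set fourier t a | t in [set: Gam]]) a.
Proof.
move=> am aC e e0; have e30 : 0 < e / 3 by rewrite divr_gt0.
have [_ [f fC <-] af] := aC _ e30.
have [S [K [K0 fS fK]]] := Cc_finite fC.
pose n : R := (size (undup S))%:R + 1.
have n0 : 0 < n by rewrite ltr_wpDl.
have K10 : 0 < K + 1 by rewrite ltr_wpDl.
have d0 : 0 < e / 3 / n / (K + 1) by rewrite !divr_gt0.
have [phi [P [uP phi0 phiS phik]]] := almost_invariant_kernel (undup S) am d0.
have pc : opcontraction (schur phi : opmatrix R G -> opmatrix R G).
  exact: schur_contraction phik.
exists (schur phi a).
  rewrite (@schur_sum _ P) //; last by move=> t tP; left; apply: phi0.
  apply: opsubspace_sum (opsubspace_span _) _ => t _.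
  have [_ _ sZ] := opsubspace_span [set fourier t a | t in [set: Gam]].
  by apply/sZ/sub_opspan; exists t.
have -> : e = e / 3 + (e / 3 + e / 3) by lra.
apply: (opnorm_sub_trans af); apply: (opnorm_sub_trans (S := schur phi (Ind f))).
  have -> : opsub (Ind f) (schur phi (Ind f)) =
      schur (fun t => 1 - phi t) (Ind f : opmatrix R G).
    by apply/funext => g; apply/funext => h; rewrite /opsub /schur mulrBl mul1r.
  have := schur_Ind_norm (phi := fun t => 1 - phi t) fC (undup_uniq S) K0 _ fK phiS.
  move=> /(_ _)/opnorm_leW; apply; last by move=> g; rewrite mem_undup; apply: fS.
  exact: sum_const_le (ltW e30) K0.
rewrite -schurB; apply: pc.2; exact: opnorm_subC.
Qed.

End Fejer.

(** * Bimodules over one fibre of the cocycle *)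

Section ComplexLimits.
Variable R : realType.
Local Notation C := (R[i]).
Local Notation "x %:C" := (real_complex R x) : ring_scope.

Lemma cvg_complexP (T : Type) (F : set_system T) (f : T -> C) (l : C) : Filter F ->
  ((f : T -> C^o) @ F --> (l : C^o) <->
   forall e : R, 0 < e -> \forall x \near F, `|l - f x| <= e%:C).
Proof.
move=> FF; split=> [/cvgrPdist_le h e e0|h]; first by apply: h; rewrite ltcR.
apply/cvgrPdist_le => e e0; have /complex_realP[r rE] := gtr0_real e0.
by rewrite rE; apply: h; rewrite -ltcR -rE.
Qed.

Lemma continuous_unif (T : topologicalType) (f : T -> C) :
  (forall e : R, 0 < e -> exists2 g : T -> C, continuous (g : T -> C^o) &
     forall x, `|f x - g x| <= e%:C) ->
  continuous (f : T -> C^o).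
Proof.
move=> h x; apply/cvg_complexP => e e0; have e30 : 0 < e / 3 by rewrite divr_gt0.
have [g gc fg] := h _ e30.
have /cvg_complexP/(_ _ e30) := gc x; apply: filterS => y gxy.
have -> : f x - f y = (f x - g x) + ((g x - g y) + (g y - f y)) by ring.
have -> : e = e / 3 + (e / 3 + e / 3) by lra.
rewrite !rmorphD /= (le_trans (ler_normD _ _)) // lerD //.
by rewrite (le_trans (ler_normD _ _)) // lerD // distrC.
Qed.

Lemma continuous_conj (T : topologicalType) (f : T -> C) :
  continuous (f : T -> C^o) -> continuous ((fun x => (f x)^*) : T -> C^o).
Proof.
move=> fc x; apply/cvg_complexP => e e0.
have /cvg_complexP/(_ e e0) := fc x; apply: filterS => y.
by rewrite -rmorphB norm_conjC.
Qed.

(** Bounds |m| / (|m|^2 + v) uniformly in m. *)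
Lemma ler_quad (u v : C) : 0 <= u -> 0 < v -> u <= (1 + v^-1) * (u ^+ 2 + v).
Proof.
move=> u0 v0; have -> : (1 + v^-1) * (u ^+ 2 + v) =
    u + ((u - 1 / 2) ^+ 2 + 3 / 4 + u ^+ 2 / v + v).
  by field; rewrite gt_eqF.
have sq : 0 <= (u - 1 / 2) ^+ 2.
  by rewrite real_exprn_even_ge0 // rpredB // ?ger0_real // divr_ge0.
have q : 0 <= 3 / 4 :> C by rewrite divr_ge0.
by rewrite lerDl !addr_ge0 ?(ltW v0) // divr_ge0 ?exprn_ge0 // ltW.
Qed.

Section ContinuousOps.
Variable T : topologicalType.
Implicit Types f g : T -> C.

Lemma continuousCM f g : continuous (f : T -> C^o) -> continuous (g : T -> C^o) ->
  continuous ((fun x => f x * g x) : T -> C^o).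
Proof. by move=> fc gc x; exact: (@cvgM C T (nbhs x) _ f g _ _ (fc x) (gc x)). Qed.

Lemma continuousCD f g : continuous (f : T -> C^o) -> continuous (g : T -> C^o) ->
  continuous ((fun x => f x + g x) : T -> C^o).
Proof. by move=> fc gc x; exact: (@cvgD C C^o T (nbhs x) _ f g _ _ (fc x) (gc x)). Qed.

Lemma continuousCV f : continuous (f : T -> C^o) -> (forall x, f x != 0) ->
  continuous ((fun x => (f x)^-1) : T -> C^o).
Proof. by move=> fc f0 x; exact: (@cvgV C T (nbhs x) _ f _ (f0 x) (fc x)). Qed.

Lemma continuousC_cst (z : C) : continuous ((fun=> z) : T -> C^o).
Proof. by move=> x; exact: cvg_cst. Qed.

Lemma continuousC_sqnorm f : continuous (f : T -> C^o) ->
  continuous ((fun x => `|f x| ^+ 2) : T -> C^o).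
Proof.
move=> fc; under eq_fun do rewrite normCK.
exact (continuousCM fc (continuous_conj fc)).
Qed.

End ContinuousOps.

Section C0.
Variable X : topologicalType.
Implicit Types b : X -> C.

Lemma C0X_unif b : (forall e : R, 0 < e -> exists2 b' : X -> C, C0X b' &
     forall x, `|b x - b' x| <= e%:C) -> C0X b.
Proof.
move=> h; split.
  by apply: continuous_unif => e /h[b' [b'c _] bb']; exists b'.
move=> e e0; have e20 : 0 < e / 2 by rewrite divr_gt0.
have [b' [_ /(_ _ e20)[K cK Kb']] bb'] := h _ e20.
exists K => // x nKx; rewrite (splitr e) rmorphD /=.
have -> : b x = (b x - b' x) + b' x by rewrite subrK.
by rewrite (le_trans (ler_normD _ _)) // lerD // Kb'.
Qed.

Lemma C0X_dominated (b b' : X -> C) (c : R) : continuous (b' : X -> C^o) ->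
  0 < c -> (forall x, `|b' x| <= c%:C * `|b x|) -> C0X b -> C0X b'.
Proof.
move=> b'c c0 dom [_ b0]; split=> // e e0.
have [K cK Kb] := b0 _ (divr_gt0 e0 c0); exists K => // x /Kb bx.
apply: (le_trans (dom x)); rewrite -(@divfK _ c _ e) ?gt_eqF // mulrC rmorphM /=.
by rewrite ler_pM2r ?ltcR.
Qed.

End C0.
End ComplexLimits.

Section Fibre.
Variables (R : realType) (Gam : groupType) (X : topologicalType).
Variable beta : partial_action Gam X.
Hypothesis X_T2 : hausdorff_space X.
Local Notation C := (R[i]).
Local Notation G := (groupoid beta).
Local Notation "x %:C" := (real_complex R x) : ring_scope.
Implicit Types (f : G -> C) (a : opmatrix R G).

Lemma CcD f g : Cc f -> Cc g -> Cc (fun h => f h + g h).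
Proof.
move=> [fc fs] [gc gs]; split; first exact (continuousCD fc gc).
apply: (@subclosed_compact _ _ (support_of f `|` support_of g)).
- exact: closed_closure.
- exact: compactU.
rewrite /support_of -closureU; apply: closure_subset => h /= fg.
have [f0|] := eqVneq (f h) 0; last by left.
by right; move: fg; rewrite f0 add0r.
Qed.

Lemma Cr_subspace : opsubspace (Cr (R := R) (beta := beta)).
Proof.
apply: opsubspace_closure; split.
- exists (fun=> 0); last first.
    by apply/funext => g; apply/funext => h; rewrite /Ind; case: asboolP.
  split; first exact (@continuousC_cst R _ 0).
  rewrite /support_of (_ : [set g | _] = set0) ?closure0; first exact: compact0.
  by apply/seteqP; split=> // g /=; rewrite eqxx.
- move=> _ _ [f fC <-] [g gC <-]; exists (fun h => f h + g h); first exact: CcD.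
  apply/funext => h; apply/funext => k; rewrite /opadd /Ind.
  by case: asboolP => _; rewrite ?addr0.
- move=> z _ [f fC <-]; exists (fun h => z * f h); first exact: (CcZ (fun=> z)).
  apply/funext => h; apply/funext => k; rewrite /opscale /Ind.
  by case: asboolP => _; rewrite ?mulr0.
Qed.

Lemma Cr_coef_continuous a : Cr a -> continuous (coef a : G -> C^o).
Proof.
move=> aC; apply: continuous_unif => e e0; have [_ [f [fc _] <-] af] := aC _ e0.
exists f => // g; have := coef_le g af; by rewrite /coef /opsub -!/(coef _ _) coef_Ind.
Qed.

Lemma arrow_near t (x : X) (tx : pdom beta t^-1%g x) (A : set G) :
  nbhs (arrow tx) A ->
  \forall y \near x, forall ty : pdom beta t^-1%g y, A (arrow ty).
Proof.
rewrite nbhsE => -[B [[D oD <-] Dx] BA].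
have actc : pact beta t @ x --> pact beta t x.
  have := @pact_cont _ _ beta t; rewrite continuous_open_subspace; last exact: pdom_open.
  by apply; rewrite inE.
have : (fun y => (pact beta t y, t : discrete_topology Gam, y)) @ x -->
    ((pact beta t x, t : discrete_topology Gam), x).
  pose p := (pact beta t x, t : discrete_topology Gam).
  apply: (@cvg_pair _ _ _ (nbhs x) (nbhs p) (nbhs x) _ _ _
    (fun y => (pact beta t y, t : discrete_topology Gam)) id) => //.
  apply: (@cvg_pair _ _ _ (nbhs x) (nbhs p.1) (nbhs p.2) _ _ _
    (pact beta t) (fun=> t : discrete_topology Gam)) => //.
  exact: cvg_cst.
move=> cv; have h : \forall y \near x, D ((pact beta t y, t : discrete_topology Gam), y).
  exact: (cv D (open_nbhs_nbhs (conj oD Dx))).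
by apply: filterS h => y Dy ty; exact: BA.
Qed.

(** The fibre over t is homeomorphic, by the source map, to the open set
  [pdom t^-1]; functions on it are extended by zero to X. *)
Definition fibre_fun t f (x : X) : C :=
  if pselect (pdom beta t^-1%g x) is left tx then f (arrow tx) else 0.

Lemma fibre_funE t f g : cocycle g = t -> fibre_fun t f (src g) = f g.
Proof.
move=> ct; rewrite /fibre_fun; case: pselect => [tx|nx].
  by congr f; apply: groupoid_ext.
by case: nx; rewrite -ct; have [] := groupoidP g.
Qed.

Lemma Cc_fibre_fun t f : Cc f -> continuous (fibre_fun t f : X -> C^o) /\
  exists2 K : set X, compact K & forall x, ~ K x -> fibre_fun t f x = 0.
Proof.
move=> [fc fs].
pose L : set G := support_of f `&` [set g | cocycle g = t].
have cL : compact L.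
  apply: subclosed_compact fs _; last by move=> g [].
  apply: closedI; first exact: closed_closure.
  rewrite (_ : [set g | _] = (@cocycle _ _ beta : G -> discrete_topology Gam) @^-1` [set t]) //.
  apply: preimage_closed; last exact: discrete_closed.
  by move=> g _; apply: cocycle_cts.
pose K := @src _ _ beta @` L.
have cK : compact K.
  by apply: continuous_compact cL; apply: continuous_subspaceT; exact: src_cts.
have Kf x : ~ K x -> fibre_fun t f x = 0.
  move=> nK; rewrite /fibre_fun; case: pselect => // tx.
  apply: support_ofN => sx; apply: nK; by exists (arrow tx).
split; last by exists K.
have clK : closed K by apply: compact_closed.
move=> x; case: (pselect (pdom beta t^-1%g x)) => [tx|ntx].
  apply/cvg_complexP => e e0.
  have /cvg_complexP/(_ e e0)/arrow_near h := fc (arrow tx).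
  have : nbhs x (pdom beta t^-1%g).
    by apply: open_nbhs_nbhs; split => //; exact: pdom_open.
  apply: filterS2 h => y h ty; rewrite /fibre_fun.
  case: pselect => // tx'; case: pselect => // ty'.
  by rewrite (_ : tx' = tx) //; exact: Prop_irrelevance.
have nK : ~ K x by move=> [g [_ ct] sx]; apply: ntx; rewrite -sx -ct; have [] := groupoidP g.
rewrite /continuous_at Kf //; apply: (@cvg_near_cst _ C^o _ _ (nbhs x)).
have : nbhs x (~` K) by apply: open_nbhs_nbhs; split => //; exact: closed_openC.
by apply: filterS => y; apply: Kf.
Qed.

Lemma C0X_fibre_fun t a : Cr a -> C0X (fibre_fun t (coef a)).
Proof.
move=> aC; apply: C0X_unif => e e0; have [_ [f fC <-] af] := aC _ e0.
have [bc [K cK Kb]] := Cc_fibre_fun t fC.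
exists (fibre_fun t f).
  by split=> // e' e'0; exists K => // x /Kb ->; rewrite normr0 ler0c ltW.
move=> x; rewrite /fibre_fun; case: pselect => [tx|_]; last by rewrite subrr normr0 ler0c ltW.
by have := coef_le (arrow tx) af; rewrite /coef /opsub -!/(coef _ _) coef_Ind.
Qed.

Lemma diag_opE (b : X -> C) (g h : G) :
  diag_op b g h = if `[< g = h >] then b (rng h) else 0.
Proof.
rewrite /diag_op; case: asboolP => [<-|gh].
  by rewrite IndE //; have [|-> _ ->] := @gdivP _ _ _ g g; rewrite ?mulgV ?eqxx.
case: (pselect (src g = src h)) => E; last by rewrite Ind_out.
rewrite IndE //; have [_ _ ->] := gdivP E; case: eqP => // c1; case: gh.
by apply: groupoid_ext => //; rewrite -[LHS](mulgVK (cocycle h)) c1 mul1g.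
Qed.

Lemma opmul_diag a (b : X -> C) g h : opmul a (diag_op b) g h = a g h * b (rng h).
Proof.
rewrite /opmul (@summability_sum1 _ _ _ h) => [|k kh]; first by rewrite diag_opE asboolT.
by rewrite diag_opE asboolF ?mulr0 //; apply/eqP.
Qed.

Lemma coef_opmul_diag a (b : X -> C) g :
  coef (opmul a (diag_op b)) g = coef a g * b (src g).
Proof. by rewrite /coef opmul_diag. Qed.

Variable M : set (opmatrix R G).
Hypothesis M_bimod : diagonal_bimodule M.

Lemma bimodule_subspace : opsubspace M.
Proof. by have [_ [? ? ?] _ _] := M_bimod. Qed.

Let Mt t : set (opmatrix R G) :=
  [set m | M m /\ forall h, cocycle h <> t -> coef m h = 0].

(** With N = sum |m_i|^2, the element
  sum m_i (m_i^* b / (N + eta)) of M has function b N / (N + eta). *)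
Lemma fibre_approx t (s : seq G) (m : G -> opmatrix R G) (b : opmatrix R G)
    (e d : R) :
  Cr b -> (forall g, cocycle g <> t -> coef b g = 0) -> (forall x, Mt t (m x)) ->
  0 < e -> 0 < d ->
  (forall g, cocycle g = t -> `|coef b g| <= e%:C \/
     d%:C <= \sum_(x <- s) `|coef (m x) g| ^+ 2) ->
  exists2 n, M n & opnorm_le e (opsub b n).
Proof.
move=> bC bt mt e0 d0 alt; have [B B0 bB] := Cr_bounded bC.
have mC x : Cr (m x) by have [MC _ _ _] := M_bimod; apply: MC; have [] := mt x.
pose eta : R := e * d / B; have eta0 : 0 < eta by rewrite !divr_gt0 ?mulr_gt0.
pose mu x := fibre_fun t (coef (m x)).
pose N y : C := \sum_(x <- s) `|mu x y| ^+ 2.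
pose bet := fibre_fun t (coef b).
have etaC : 0 < eta%:C by rewrite ltcR.
have N0 y : 0 <= N y by apply: sumr_ge0 => x _; rewrite exprn_ge0.
have Np y : 0 < N y + eta%:C by rewrite ltr_wpDl.
have [betc bet0] := C0X_fibre_fun t bC.
have muc x : continuous (mu x : X -> C^o) by have [] := C0X_fibre_fun t (mC x).
have Nc : continuous (N : X -> C^o).
  rewrite /N; elim: (s) => [|x s' IH].
    by under eq_fun do rewrite big_nil; exact (@continuousC_cst R _ 0).
  under eq_fun do rewrite big_cons.
  exact (continuousCD (continuousC_sqnorm (muc x)) IH).
pose w x y : C := (mu x y)^* * (bet y / (N y + eta%:C)).
have w0 x : x \in s -> C0X (w x).
  move=> xs; apply: (@C0X_dominated _ _ bet _ (1 + eta^-1)).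
  - have Nn0 y : N y + eta%:C != 0 by rewrite gt_eqF.
    have Nec := continuousCV (continuousCD Nc (@continuousC_cst R _ eta%:C)) Nn0.
    exact (continuousCM (continuous_conj (muc x)) (continuousCM betc Nec)).
  - by rewrite addr_gt0 // invr_gt0.
  - move=> y; rewrite /w !normrM norm_conjC normfV (gtr0_norm (Np y)).
    rewrite mulrA mulrAC ler_wpM2r // ler_pdivrMr // rmorphD rmorph1 fmorphV.
    have muN : `|mu x y| ^+ 2 <= N y.
      rewrite /N (big_rem x) //= lerDl; apply: sumr_ge0 => z _; exact: exprn_ge0.
    apply: (@le_trans _ _ ((1 + (eta%:C)^-1) * (`|mu x y| ^+ 2 + eta%:C))); last first.
      by rewrite ler_wpM2l ?lerD2r // addr_ge0 // invr_ge0 ltW.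
    by rewrite ler_quad.
  - exact (conj betc bet0).
pose n : opmatrix R G := fun g h => \sum_(x <- s) opmul (m x) (diag_op (w x)) g h.
have Mn : M n.
  apply: opsubspace_sum bimodule_subspace _ => x xs.
  have [_ _ _ mul] := M_bimod; by have [] := mul _ _ (mt x).1 (w0 x xs).
exists n => //.
have coefn g : coef n g = \sum_(x <- s) coef (m x) g * w x (src g).
  by apply: eq_bigr => x _; rewrite -coef_opmul_diag.
have [MC _ _ _] := M_bimod.
have coefB g : coef (opsub b n) g = coef b g - coef n g by [].
have BC : Cr (opsub b n).
  by apply: (opsubspace_sub Cr_subspace) => //; exact: MC.
apply: (@fibre_norm _ _ _ _ _ t) => //; first exact: ltW.
  move=> g ct; rewrite coefB bt // coefn big1 ?subr0 // => x _.
  by have [_ ->] := mt x; rewrite ?mul0r.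
move=> g; have [ct|ct] := pselect (cocycle g = t); last first.
  rewrite coefB bt // coefn big1 ?subr0 ?normr0 ?ler0c ?ltW // => x _.
  by have [_ ->] := mt x; rewrite ?mul0r.
have muE x : mu x (src g) = coef (m x) g by rewrite /mu fibre_funE.
have betE : bet (src g) = coef b g by rewrite /bet fibre_funE.
have NE : coef n g = coef b g * (N (src g) / (N (src g) + eta%:C)).
  rewrite coefn {1}/N mulr_suml mulr_sumr; apply: eq_bigr => x _.
  by rewrite /w muE betE normCK; ring.
rewrite coefB NE.
have -> : coef b g - coef b g * (N (src g) / (N (src g) + eta%:C)) =
    coef b g * (eta%:C / (N (src g) + eta%:C)).
  by field; rewrite gt_eqF.
rewrite normrM normrM normfV (gtr0_norm etaC) (gtr0_norm (Np _)).
have [small|big] := alt g ct.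
  apply: le_trans small; rewrite ler_piMr // ler_pdivrMr // mul1r lerDr; exact: N0.
have Nd : d%:C <= N (src g).
  by apply: (le_trans big); rewrite le_eqVlt; apply/orP; left; apply/eqP;
     apply: eq_bigr => x _; rewrite muE.
rewrite mulrA ler_pdivrMr //.
apply: (@le_trans _ _ (B%:C * eta%:C)); first by rewrite ler_pM2r // coef_le.
have -> : B%:C * eta%:C = e%:C * d%:C.
  by rewrite -!rmorphM /eta; congr (_%:C); field; rewrite gt_eqF.
by rewrite ler_pM2l ?ltcR // (le_trans Nd) // lerDl ltW.
Qed.

(** Within one fibre M is a C_0-module of functions, hence determined by its
  support: cover the compact set where b is not small by finitely many open sets
  on which members of M do not vanish. *)
Lemma fibre_spectral t (b : opmatrix R G) : Cr b ->
  (forall g, cocycle g <> t -> coef b g = 0) ->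
  (forall g, coef b g != 0 -> exists2 m, Mt t m & coef m g != 0) -> M b.
Proof.
move=> bC bt supp; have [MC [M0 _ _] Mcl _] := M_bimod; apply: Mcl => e e0.
have e20 : 0 < e / 2 by rewrite divr_gt0.
have e40 : 0 < e / 4 by rewrite divr_gt0.
have [_ [f fC <-] bf] := bC _ e40.
have bfg g : `|coef b g - f g| <= (e / 4)%:C.
  by have := coef_le g bf; rewrite /coef /opsub -!/(coef _ _) coef_Ind.
(* The value 0 is only taken at the points where b vanishes. *)
pose mm g : opmatrix R G := xget (@opzero R G) [set m | Mt t m /\ coef m g != 0].
have mmt g : Mt t (mm g).
  by rewrite /mm; case: xgetP => [m _ []//|_]; split.
have mmP g : coef b g != 0 -> coef (mm g) g != 0.
  by move=> /supp[m mt mg]; rewrite /mm; case: xgetP => [m' _ []//|/(_ m)[]].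
pose L : set G := support_of f.
pose Q g h : Prop := `|f h| <= (e / 2)%:C \/
  coef (mm g) g != 0 /\ `|coef (mm g) g| / 2 <= `|coef (mm g) h|.
have nearQ g : L g -> \forall h \near g, Q g h.
  move=> _; have fc := fC.1; have [bg|bg] := eqVneq (coef b g) 0.
    have /cvg_complexP/(_ _ e40) := fc g; apply: filterS => h fh; left.
    have -> : f h = (f h - f g) + (f g - coef b g) by rewrite bg; ring.
    rewrite (_ : e / 2 = e / 4 + e / 4); last lra.
    by rewrite rmorphD (le_trans (ler_normD _ _)) // lerD // distrC.
  have mg := mmP g bg; have mC : Cr (mm g) by apply: MC; have [] := mmt g.
  have [r r0 rE] := normC_real (coef (mm g) g).
  have r20 : 0 < r / 2.
    by rewrite divr_gt0 // lt_def r0 andbT -(inj_eq (@complexI R)) -rE normr_eq0.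
  have /cvg_complexP/(_ _ r20) := Cr_coef_continuous mC (x := g).
  apply: filterS => h mgh; right; split=> //.
  have := le_trans (lerB_dist _ _) mgh; rewrite rE lerBlDr {1}(splitr r) rmorphD.
  by rewrite lerD2l rmorphM fmorphV rmorph_nat.
have [s [_ cov]] := compact_finite_cover fC.2 nearQ.
have [d d0 ds] : exists2 d : R, 0 < d & forall g, g \in s ->
    coef (mm g) g != 0 -> d%:C <= (`|coef (mm g) g| / 2) ^+ 2.
  elim: s {cov} => [|g s [d d0 IH]]; first by exists 1.
  have [r r0 rE] := normC_real (coef (mm g) g).
  have [g0|g0] := eqVneq (coef (mm g) g) 0.
    by exists d => // h; rewrite in_cons => /predU1P[->|/IH//]; rewrite g0 eqxx.
  have rp : 0 < (r / 2) ^+ 2.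
    by rewrite exprn_gt0 // divr_gt0 // lt_def r0 andbT -(inj_eq (@complexI R)) -rE normr_eq0.
  exists (Num.min d ((r / 2) ^+ 2)); first by rewrite lt_min d0.
  move=> h; rewrite in_cons => /predU1P[->|hs] h0.
    have -> : (`|coef (mm g) g| / 2) ^+ 2 = ((r / 2) ^+ 2)%:C.
      by rewrite rE rmorphXn rmorphM fmorphV rmorph_nat.
    by rewrite lecR ge_min lexx orbT.
  by apply: le_trans (IH h hs h0); rewrite lecR ge_min lexx.
apply: (@fibre_approx t s mm b e d) => // g ct.
have small : `|f g| <= (e / 2)%:C -> `|coef b g| <= e%:C.
  move=> fg; have -> : coef b g = (coef b g - f g) + f g by rewrite subrK.
  apply: (@le_trans _ _ (e / 4 + e / 2)%:C); last by rewrite lecR; lra.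
  by rewrite rmorphD (le_trans (ler_normD _ _)) // lerD.
have [Lg|fg] := pselect (L g); last first.
  by left; apply: small; rewrite support_ofN // normr0 ler0c ltW.
have [x xs [fg|[mx le]]] := cov g Lg; first by left; apply: small.
right; apply: (le_trans (ds x xs mx)).
apply: (@le_trans _ _ (`|coef (mm x) g| ^+ 2)).
  by rewrite ler_pXn2r ?nnegrE // divr_ge0.
by rewrite (big_rem x) //= lerDl; apply: sumr_ge0 => z _; exact: exprn_ge0.
Qed.

(** If the Fourier coefficients of members of M stay in M, then M is recovered
  from its support: fibre by fibre, then by Fejer summation. *)
Lemma spectral_of_fourier : amenable_group R Gam ->
  (forall t a, M a -> M (fourier t a)) -> spectral M.
Proof.
move=> am Mf; have [MC _ Mcl _] := M_bimod.
apply/seteqP; split=> [a Ma|a [aC as0]].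
  split; first exact: MC.
  by move=> g ng; apply/eqP/negP => /negP ag; apply: ng; exists a.
apply: Mcl; apply: opclosureS (fejer am aC).
apply: opspan_min; first exact/opsubspace_closure/bimodule_subspace.
move=> _ [t _ <-]; apply/sub_opclosure/(@fibre_spectral t).
- exact: fourier_Cr.
- by move=> g ct; rewrite coef_fourier; case: eqP.
move=> g; rewrite coef_fourier; case: (cocycle g =P t) => [ct ag|_]; last by rewrite eqxx.
have [m Mm mg] : sigma M g by apply: contrapT => /as0 E; rewrite E eqxx in ag.
exists (fourier t m); last by rewrite coef_fourier ct eqxx.
by split=> [|h ch]; [exact: Mf | rewrite coef_fourier; case: eqP].
Qed.

End Fibre.

(** * Characters and the dual action *)

Section Characters.
Variables (R : realType) (Gam : groupType).
Local Notation C := (R[i]).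
Local Notation "x %:C" := (real_complex R x) : ring_scope.
Hypothesis mulC : abelian_group Gam.
Implicit Types (H : set Gam) (chi : Gam -> C) (x h : Gam).

Definition partial_character H chi : Prop :=
  [/\ H 1%g, forall h k, H h -> H k -> H (h * k)%g, forall h, H h -> H h^-1%g,
      forall h k, H h -> H k -> chi (h * k)%g = chi h * chi k &
      forall h, H h -> `|chi h| = 1].

Lemma partial_characterX H chi h n : partial_character H chi -> H h ->
  H (h ^+ n)%g /\ chi (h ^+ n)%g = chi h ^+ n.
Proof.
move=> [H1 HM _ cM c1] Hh; elim: n => [|n [IH IHc]].
  split=> //; rewrite expg0 expr0.
  have n0 : chi 1%g != 0 by rewrite -normr_eq0 c1 // oner_eq0.
  by apply: (mulfI n0); rewrite mulr1 -cM // mulg1.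
by rewrite expgS exprS cM // IHc; split=> //; apply: HM.
Qed.

Lemma norm1_neq0 (z : C) : `|z| = 1 -> z != 0.
Proof. by move=> z1; rewrite -normr_eq0 z1 oner_eq0. Qed.

Lemma norm1_root (z : C) n : (0 < n)%N -> `|z ^+ n| = 1 -> `|z| = 1.
Proof.
move=> n0; rewrite normrX => /eqP; rewrite pexpr_eq1 //.
by move/eqP.
Qed.

(** Either x is free over H, or its powers that lie in H are generated by the
  least positive one. *)
Lemma least_power H chi x : partial_character H chi ->
  (forall n, H (x ^+ n)%g -> n = 0%N) \/
  exists2 k, (0 < k)%N & H (x ^+ k)%g /\ forall n, H (x ^+ n)%g -> (k %| n)%N.
Proof.
move=> pc; have [H1 HM HV _ _] := pc.
case: (pselect (exists n, (0 < n)%N && `[< H (x ^+ n)%g >])) => [ex|nex]; last first.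
  left=> n Hn; apply/eqP; rewrite eqn0Ngt; apply/negP => n0; apply: nex.
  by exists n; rewrite n0; apply/asboolP.
right; case: (ex_minnP ex) => k /andP[k0 /asboolP Hk] kmin; exists k => //.
split=> // n Hn; rewrite /dvdn; apply: contraT; rewrite -lt0n => r0.
have Hr : H (x ^+ (n %% k))%g.
  have -> : (x ^+ (n %% k))%g = (((x ^+ k) ^+ (n %/ k))^-1 * x ^+ n)%g.
    by rewrite {3}(divn_eq n k) expgnDr mulnC expgnA mulKg.
  by apply: HM => //; apply: HV; have [] := partial_characterX (n %/ k) pc Hk.
have := kmin (n %% k)%N; rewrite r0 => /(_ (introT (asboolP _) Hr)).
by rewrite leqNgt ltn_mod k0.
Qed.

Definition compatible H chi x (z : C) : Prop :=
  `|z| = 1 /\ forall n, H (x ^+ n)%g -> chi (x ^+ n)%g = z ^+ n.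

(** The circle is divisible: the least positive power x^k in H prescribes only
  the k-th power of z. *)
Lemma exists_compatible H chi x : partial_character H chi ->
  exists z, compatible H chi x z.
Proof.
move=> pc; have [_ _ _ _ c1] := pc.
have c11 : chi 1%g = 1.
  by have [_] := partial_characterX 0 pc (let: And5 h _ _ _ _ := pc in h); rewrite expg0 expr0.
have [no|[k k0 [Hk kd]]] := least_power x pc.
  by exists 1; split=> [|n /no->]; rewrite ?normr1 // expg0.
exists (k.-root (chi (x ^+ k)%g)); split.
  by apply: (norm1_root k0); rewrite rootCK // c1.
move=> n Hn; rewrite -(divnK (kd n Hn)) mulnC exprM rootCK // expgnA.
by have [_ ->] := partial_characterX (n %/ k) pc Hk.
Qed.

(** A root of 1 + z + ... + z^(k - 1). *)
Lemma root_of_unity k : (1 < k)%N -> exists2 z : C, z ^+ k = 1 & z != 1.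
Proof.
case: k => [//|[//|k]] _.
have [z zE] := @solve_monicpoly C k.+1 (fun=> -1) isT.
have s0 : \sum_(i < k.+2) z ^+ i = 0.
  rewrite big_ord_recr /= zE -big_split big1 // => i _ /=.
  by rewrite mulN1r subrr.
exists z.
  by apply/eqP; rewrite -subr_eq0 subrX1 s0 mulr0.
apply/eqP => z1; move: s0; rewrite z1.
under eq_bigr do rewrite expr1n.
rewrite sumr_const card_ord => /eqP; by rewrite pnatr_eq0.
Qed.

(** Elements h x^i x^-j are handled through y x^j = h x^i, which avoids negative
  exponents; compatibility of z makes chi (h) z^(i - j) independent of h, i, j. *)
Lemma extend_character H chi x z : partial_character H chi -> compatible H chi x z ->
  exists H' chi', [/\ partial_character H' chi', H `<=` H',
     forall h, H h -> chi' h = chi h, H' x & chi' x = z].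
Proof.
move=> pc [z1 cz]; have [H1 HM HV cM c1] := pc.
have z0 := norm1_neq0 z1.
have mAC (a b c : Gam) : (a * b * c = a * c * b)%g by rewrite -!mulgA (mulC b).
have mACA (a b c d : Gam) : (a * b * (c * d) = a * c * (b * d))%g.
  by rewrite mulgA (mAC a b c) -!mulgA.
have key h h' a b : H h -> H h' -> (h * x ^+ a = h' * x ^+ b)%g ->
    chi h * z ^+ a = chi h' * z ^+ b.
  wlog ab : h h' a b / (a <= b)%N.
    move=> hw Hh Hh' E; have /orP[ab|ba] := leq_total a b; first exact: hw.
    by symmetry; apply: hw.
  move=> Hh Hh' E; have E' : (x ^+ (b - a) = h'^-1 * h)%g.
    have hE : h = (h' * x ^+ b / x ^+ a)%g by rewrite -E mulgK.
    by rewrite expgnFr // hE -!mulgA mulKg.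
  have Hx : H (x ^+ (b - a))%g by rewrite E'; apply: HM => //; apply: HV.
  have -> : chi h = chi h' * z ^+ (b - a).
    by rewrite -(cz _ Hx) -cM // E' mulVKg.
  by rewrite -mulrA -exprD subnK.
pose V y v := exists h i j, [/\ H h, (y * x ^+ j = h * x ^+ i)%g &
   v = chi h * z ^+ i / z ^+ j].
have Vfun y v v' : V y v -> V y v' -> v = v'.
  move=> [h [i [j [Hh E ->]]]] [h' [i' [j' [Hh' E' ->]]]].
  have /key-/(_ Hh Hh') : (h * x ^+ (i + j') = h' * x ^+ (i' + j))%g.
    by rewrite !expgnDr !mulgA -E -E' mAC.
  rewrite !exprD => K; apply/eqP.
  by rewrite eqr_div ?expf_neq0 // -mulrA K mulrA.
have VM y v y' v' : V y v -> V y' v' -> V (y * y')%g (v * v').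
  move=> [h [i [j [Hh E ->]]]] [h' [i' [j' [Hh' E' ->]]]].
  exists (h * h')%g, (i + i')%N, (j + j')%N; split; first exact: HM.
    by rewrite !expgnDr mACA E E' mACA.
  by rewrite cM // !exprD invfM; ring.
have VV y v : V y v -> V y^-1%g v^-1.
  move=> [h [i [j [Hh E ->]]]]; exists h^-1%g, j, i; split; first exact: HV.
    have -> : (x ^+ i = h^-1 * (y * x ^+ j))%g by rewrite E mulKg.
    by rewrite mulgA (mulC y^-1%g) -mulgA mulKg.
  have ch : chi h^-1%g = (chi h)^-1.
    apply: (mulfI (norm1_neq0 (c1 h Hh))); rewrite -cM ?mulgV //; last exact: HV.
    rewrite mulfV ?norm1_neq0 ?c1 //.
    by have [_] := partial_characterX 0 pc H1; rewrite expg0 expr0.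
  by rewrite ch !invfM invrK mulrAC.
have VH h : H h -> V h (chi h).
  by move=> Hh; exists h, 0%N, 0%N; split; rewrite ?expr0 ?mulr1 ?divr1.
have Vx : V x z.
  exists 1%g, 1%N, 0%N; split; [exact: H1 | |]; first by rewrite expg0 expg1 mulg1 mul1g.
  have [_] := partial_characterX 0 pc H1; rewrite expg0 !expr0 => ->.
  by rewrite mul1r divr1.
pose chi' y := xget 0 (V y).
have chi'E y v : V y v -> chi' y = v.
  by move=> Vv; apply: (Vfun y _ _ _ Vv); apply: xgetPex; exists v.
exists [set y | exists v, V y v], chi'; split.
- split=> [|y y' [v Vv] [v' Vv']|y [v Vv]|y y' [v Vv] [v' Vv']|y [v Vv]].
  + by exists (chi 1%g); apply: VH.
  + by exists (v * v'); apply: VM.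
  + by exists v^-1; apply: VV.
  + by rewrite (chi'E _ _ Vv) (chi'E _ _ Vv'); apply/chi'E/VM.
  + rewrite (chi'E _ _ Vv); case: Vv => h [i [j [Hh _ ->]]].
    by rewrite !normrM normfV !normrX z1 c1 // !expr1n invr1 !mulr1.
- by move=> h Hh; exists (chi h); apply: VH.
- by move=> h Hh; apply/chi'E/VH.
- by exists z.
- exact: chi'E.
Qed.

(** The characters of a discrete abelian group separate its points: start from
  a nontrivial value at s and extend to a maximal partial character. *)
Lemma separating_character (s : Gam) : s <> 1%g ->
  exists2 chi : Gam -> C, group_character chi & chi s != 1.
Proof.
move=> s1.
have pc1 : partial_character [set 1%g] (fun=> 1).
  split=> [|h k -> ->|h ->|h k _ _|h _]; rewrite ?mulg1 ?invg1 ?mulr1 ?normr1 //.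
have [z cz zn] : exists2 z, compatible [set 1%g] (fun=> 1) s z & z != 1.
  have [no|[k k0 [Hk kd]]] := least_power s pc1.
    exists (-1); first by split=> [|n /no->]; rewrite ?normrN1.
    by rewrite -subr_eq0 -opprD oppr_eq0 -mulr2n pnatr_eq0.
  have k1 : (1 < k)%N.
    case: k k0 Hk {kd} => [|[|k]] // _; by rewrite /= expg1 => /s1.
  have [z zk zn] := root_of_unity k1; exists z => //; split.
    by apply: (norm1_root k0); rewrite zk normr1.
  by move=> n Hn; rewrite -(divnK (kd n Hn)) mulnC exprM zk expr1n.
have [H0 [chi0 [pc0 _ _ H0s chi0s]]] := extend_character pc1 cz.
pose T := {p : set Gam * (Gam -> C) |
  [/\ partial_character p.1 p.2, p.1 s & p.2 s = z]}.
pose rel (p q : T) := `[< (sval p).1 `<=` (sval q).1 /\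
  forall h, (sval p).1 h -> (sval q).2 h = (sval p).2 h >].
pose mkT H chi (h1 : partial_character H chi) (h2 : H s) (h3 : chi s = z) : T :=
  exist _ (H, chi) (And3 h1 h2 h3).
have [|||[[H chi] /= [pc Hs cs]] pmax] := @ZL_preorder T (mkT H0 chi0 pc0 H0s chi0s) rel.
- by move=> p; apply/asboolP; split.
- move=> q p r /asboolP[qp qpc] /asboolP[pr prc]; apply/asboolP; split.
    exact: subset_trans pr.
  by move=> h qh; rewrite prc ?qpc //; apply: qp.
- move=> A tot; case: (pselect (A !=set0)) => [[p0 Ap0]|A0]; last first.
    by exists (mkT H0 chi0 pc0 H0s chi0s) => p Ap; case: A0; exists p.
  pose HU : set Gam := \bigcup_(p in A) (sval p).1.
  pose chU h : C := xget 0 [set v | exists p, [/\ A p, (sval p).1 h & v = (sval p).2 h]].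
  have chUE p h : A p -> (sval p).1 h -> chU h = (sval p).2 h.
    move=> Ap ph; rewrite /chU; case: xgetP => [_ _ [q [Aq qh ->]]|/(_ ((sval p).2 h))].
      by have [/asboolP[_ E]|/asboolP[_ E]] := tot p q Ap Aq; rewrite E.
    by case; exists p.
  have two h k : HU h -> HU k -> exists p, [/\ A p, (sval p).1 h & (sval p).1 k].
    move=> [p Ap ph] [q Aq qk].
    have [/asboolP[pq _]|/asboolP[qp _]] := tot p q Ap Aq.
      by exists q; split=> //; apply: pq.
    by exists p; split=> //; apply: qp.
  have pcU : partial_character HU chU.
    split.
    + by exists p0 => //; have [[]] := svalP p0.
    + move=> h k Hh Hk; have [p [Ap ph pk]] := two h k Hh Hk; exists p => //.
      by have [[_ pM _ _ _] _ _] := svalP p; apply: pM.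
    + move=> h [p Ap ph]; exists p => //; have [[_ _ pV _ _] _ _] := svalP p; exact: pV.
    + move=> h k Hh Hk; have [p [Ap ph pk]] := two h k Hh Hk.
      have [[_ pM _ pc _] _ _] := svalP p.
      by rewrite !(chUE p) ?pc //; apply: pM.
    + move=> h [p Ap ph]; have [[_ _ _ _ p1] _ _] := svalP p.
      by rewrite (chUE p) // p1.
  have [_ p0s p0z] := svalP p0.
  have HUs : HU s by exists p0.
  have chUs : chU s = z by rewrite (chUE p0).
  exists (mkT HU chU pcU HUs chUs) => p Ap; apply/asboolP; split=> /=.
    by move=> h ph; exists p.
  by move=> h ph; apply: chUE.
have full x : H x.
  have [w cw] := exists_compatible x pc.
  have [H' [chi' [pc' HH' cc' H'x _]]] := extend_character pc cw.
  have c's : chi' s = z by rewrite cc'.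
  have /asboolP[/= H'H _] := pmax (mkT H' chi' pc' (HH' _ Hs) c's)
    (introT (asboolP _) (conj HH' cc')).
  exact: H'H.
have [_ _ _ cM c1] := pc.
exists chi; last by rewrite cs.
by split=> [a b|a]; [apply: cM | apply: c1].
Qed.

End Characters.

Section Alpha.
Variables (R : realType) (Gam : groupType) (X : topologicalType).
Variable beta : partial_action Gam X.
Local Notation C := (R[i]).
Local Notation G := (groupoid beta).
Local Notation "x %:C" := (real_complex R x) : ring_scope.
Implicit Types (f : G -> C) (a : opmatrix R G) (chi psi : Gam -> C).

Lemma alphaE chi a : group_character chi -> Cr a -> alpha chi a = schur chi a.
Proof.
move=> chic aC; have sC := schur_Cr (character_contraction beta chic) aC.
rewrite /alpha; case: xgetP => [b _ [bC bE]|/(_ (schur chi a))[]].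
  by apply: Cr_eq => // g; rewrite bE coef_schur.
by split=> // g; rewrite coef_schur.
Qed.

Variable M : set (opmatrix R G).
Hypothesis M_bimod : diagonal_bimodule M.

(** An algebraic substitute for the averages of chi (t)^-1 chi over finite sets of
  characters, closed under products. *)
Definition averager t psi : Prop :=
  [/\ psi t = 1, forall s, `|psi s| <= 1,
      opcontraction (schur psi : opmatrix R G -> opmatrix R G) &
      forall a, M a -> M (schur psi a)].

Lemma averagerM t psi psi' : averager t psi -> averager t psi' ->
  averager t (fun s => psi s * psi' s).
Proof.
move=> [p1 pb pc pM] [p1' pb' pc' pM'].
have E a : schur (fun s => psi s * psi' s) a = schur psi (schur psi' a).
  by apply/funext => g; apply/funext => h; rewrite /schur mulrA.
split; first by rewrite p1 p1' mulr1.
- by move=> s; rewrite normrM mulr_ile1.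
- split=> [a b|K a aK]; first exact: schurB.
  by rewrite E; apply: pc.2; apply: pc'.2.
- by move=> a Ma; rewrite E; apply/pM/pM'.
Qed.

Lemma averager1 t : averager t (fun=> 1).
Proof.
have E a : schur (fun=> 1) a = a.
  by apply/funext => g; apply/funext => h; rewrite /schur mul1r.
split=> //; first by rewrite normr1.
  by split=> [a b|K a]; rewrite ?E.
by move=> a; rewrite E.
Qed.

Lemma averagerX t psi n : averager t psi -> averager t (fun u => psi u ^+ n).
Proof.
move=> h; elim: n => [|n IH].
  by under eq_fun do rewrite expr0; exact: averager1.
by under eq_fun do rewrite exprS; exact: averagerM.
Qed.

Lemma norm_half_lt1 (z : C) : `|z| = 1 -> z != 1 -> `|(1 + z) / 2| < 1.
Proof.
move=> z1 zn; rewrite normrM normfV [X in _ / X]ger0_norm // ltr_pdivrMr // mul1r.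
rewrite lt_neqAle (le_trans (ler_normD _ _)) ?normr1 ?z1 // andbT.
apply/negP => /eqP E; case/negP: zn; apply/eqP.
have := normCDeq (x := 1) (y := z); rewrite normr1 z1 => /(_ E)[t t1 [tE1 tE2]].
by move: tE1 tE2; rewrite !mul1r => <-.
Qed.

Hypothesis mulC : abelian_group Gam.
Hypothesis inv : alpha_invariant M.

(** The multiplier (1 + chi (t)^-1 chi) / 2, for a character chi that separates s
  from t. *)
Lemma averager_lt1 t s : s <> t -> exists2 psi, averager t psi & `|psi s| < 1.
Proof.
move=> st; have [MC [_ MD MZ] _ _] := M_bimod.
have [|chi chic cs] := @separating_character R Gam mulC (s * t^-1)%g.
  by move=> E; apply: st; rewrite -(mulgVK t s) E mul1g.
have [cM c1] := chic.
have ct : chi t^-1%g * chi t = 1.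
  have n0 : chi 1%g != 0 by apply: norm1_neq0.
  by rewrite -cM mulVg; apply: (mulfI n0); rewrite mulr1 -cM mulg1.
pose psi u := (1 + chi t^-1%g * chi u) / 2.
have E a : schur psi a = opscale (1 / 2) (opadd a (opscale (chi t^-1%g) (schur chi a))).
  apply/funext => g; apply/funext => h.
  by rewrite /schur /opscale /opadd /psi; field.
have n12 : `|1 / 2 : C| <= (1 / 2)%:C.
  by rewrite ger0_norm ?divr_ge0 // rmorphM fmorphV rmorph1 rmorph_nat.
exists psi; last by apply: norm_half_lt1; rewrite -cM mulC // c1.
split.
- by rewrite /psi ct; field.
- move=> u; rewrite /psi normrM normfV [X in _ / X]ger0_norm // ler_pdivrMr // mul1r.
  by rewrite (le_trans (ler_normD _ _)) // normr1 normrM !c1 mulr1.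
- split=> [a b|K a aK]; first exact: schurB.
  rewrite E (_ : K = 1 / 2 * (K + 1 * K)); last by field.
  apply: opnormZ n12 _; apply: opnormD => //; apply: opnormZ; first by rewrite c1.
  exact: (character_contraction beta chic).2.
- move=> a Ma; rewrite E; apply/MZ/MD => //; apply: MZ.
  by rewrite -alphaE //; [apply: inv; last exists a | exact: MC].
Qed.

Lemma real_expr_small (r e : R) : 0 <= r -> r < 1 -> 0 < e -> exists n : nat, r ^+ n <= e.
Proof.
move=> r0 r1 e0; have : `|r| < 1 by rewrite ger0_norm.
move=> /cvg_expr/cvgr0_norm_le/(_ e e0)[n _ /(_ n (leqnn n))] h.
by exists n; rewrite -[r ^+ n]ger0_norm ?exprn_ge0.
Qed.

Lemma averager_small t (S : seq Gam) (e : R) : 0 < e -> exists2 psi, averager t psi &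
  forall s, s \in S -> s <> t -> `|psi s| <= e%:C.
Proof.
move=> e0; elim: S => [|s S [psi pa pS]]; first by exists (fun=> 1) => //; exact: averager1.
have [->|/eqP st] := eqVneq s t.
  exists psi => // u; rewrite in_cons => /predU1P[->//|]; exact: pS.
have [phi fa fs] := averager_lt1 st; have [r r0 rE] := normC_real (phi s).
have [n rn] : exists n : nat, r ^+ n <= e.
  by apply: real_expr_small => //; rewrite -ltcR -rE rmorph1.
exists (fun u => psi u * phi u ^+ n).
  by apply: averagerM => //; apply: averagerX.
have [_ pb _ _] := pa; have [_ fb _ _] := fa.
move=> u uS ut; rewrite normrM; move: uS; rewrite in_cons => /predU1P[->|uS].
  rewrite normrX rE -rmorphXn.
  apply: (@le_trans _ _ (r ^+ n)%:C); last by rewrite lecR.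
  by rewrite ler_piMl // ler0c exprn_ge0.
apply: le_trans (pS u uS ut); by rewrite ler_piMr // normrX exprn_ile1.
Qed.

(** On f in C_c with finitely many Fourier coefficients, an averager that is small
  off t is close to [fourier t]; both are contractions. *)
Lemma fourier_of_alpha t a : M a -> M (fourier t a).
Proof.
have [MC _ Mcl _] := M_bimod; move=> Ma; have aC := MC a Ma.
apply: Mcl => e e0; have e30 : 0 < e / 3 by rewrite divr_gt0.
have [_ [f fC <-] af] := aC _ e30.
have [S [K [K0 fS fK]]] := Cc_finite fC.
pose n : R := (size (undup S))%:R + 1.
have n0 : 0 < n by rewrite ltr_wpDl.
have K10 : 0 < K + 1 by rewrite ltr_wpDl.
have d0 : 0 < e / 3 / n / (K + 1) by rewrite !divr_gt0.
have [psi [p1 pb pc pM] pS] := averager_small t (undup S) d0.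
exists (schur psi a); first exact: pM.
have -> : e = e / 3 + (e / 3 + e / 3) by lra.
apply: (opnorm_sub_trans (S := fourier t (Ind f))).
  have [fB fN] : opcontraction (fourier t : opmatrix R G -> opmatrix R G).
    exact: fourier_contraction.
  by rewrite -fB; apply: fN.
apply: (opnorm_sub_trans (S := schur psi (Ind f))); last first.
  by rewrite -schurB; apply: pc.2; exact: opnorm_subC.
have -> : opsub (fourier t (Ind f)) (schur psi (Ind f)) =
    schur (fun s => (s == t)%:R - psi s) (Ind f : opmatrix R G).
  by apply/funext => g; apply/funext => h; rewrite /opsub /fourier /schur mulrBl.
have pd s : s \in undup S -> `|(s == t)%:R - psi s| <= (e / 3 / n / (K + 1))%:C.
  move=> sS; case: eqP => [->|st]; first by rewrite p1 subrr normr0 ler0c ltW.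
  by rewrite sub0r normrN; apply: pS.
have := schur_Ind_norm (phi := fun s => (s == t)%:R - psi s) fC (undup_uniq S) K0 _ fK pd.
move=> /(_ _)/opnorm_leW; apply; last by move=> g; rewrite mem_undup; apply: fS.
exact: sum_const_le (ltW e30) K0.
Qed.

End Alpha.

(** * The dual coaction *)

Section Coaction.
Variables (R : realType) (Gam : groupType) (X : topologicalType).
Variable beta : partial_action Gam X.
Hypothesis X_T2 : hausdorff_space X.
Local Notation C := (R[i]).
Local Notation G := (groupoid beta).
Local Notation "x %:C" := (real_complex R x) : ring_scope.
Local Notation lambda := (left_regular R (Gam := Gam)).
Implicit Types (f : G -> C) (a b : opmatrix R G).

(** Conjugation of a (x) 1 by the unitary delta_g (x) delta_s |->
  delta_g (x) delta_(c(g) s). *)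
Definition dual_coaction a : opmatrix R (G * Gam)%type := fun p q =>
  if ((cocycle p.1)^-1 * p.2 == (cocycle q.1)^-1 * q.2)%g then a p.1 q.1 else 0.

Lemma dual_coactionD a b :
  dual_coaction (opadd a b) = opadd (dual_coaction a) (dual_coaction b).
Proof.
apply/funext => p; apply/funext => q; rewrite /opadd /dual_coaction.
by case: ifP; rewrite ?addr0.
Qed.

Lemma dual_coactionZ z a : dual_coaction (opscale z a) = opscale z (dual_coaction a).
Proof.
apply/funext => p; apply/funext => q; rewrite /opscale /dual_coaction.
by case: ifP; rewrite ?mulr0.
Qed.

Lemma dual_coaction_adj a : dual_coaction (opadj a) = opadj (dual_coaction a).
Proof.
apply/funext => p; apply/funext => q; rewrite /opadj /dual_coaction eq_sym.
by case: ifP; rewrite ?rmorph0.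
Qed.

(** In the product, the index (g, s) contributes only for the value of s that is
  determined by g, so the sum over G * Gam is a sum over G. *)
Lemma dual_coactionM a b :
  dual_coaction (opmul a b) = opmul (dual_coaction a) (dual_coaction b).
Proof.
apply/funext => p; apply/funext => q.
pose h (g : G) := (g, cocycle g * ((cocycle p.1)^-1 * p.2))%g.
have hI : injective h by move=> g g' [].
rewrite {2}/opmul (summability_sum_inj hI).
  rewrite /dual_coaction; case: ifP => E; last first.
    rewrite (summability_sum1 (i0 := p.1)) => [|g _] /=; rewrite mulKg E mulr0 //.
  apply: (congr1 (summability.sum (R := C^o))); apply/funext => g /=.
  by rewrite mulKg eqxx E.
move=> [g s] nh; rewrite {1}/dual_coaction /=; case: eqP => [E|_]; last by rewrite mul0r.
by have := nh g; rewrite /h E mulVKg eqxx.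
Qed.

Lemma dual_coaction_contraction : opcontraction dual_coaction.
Proof.
split=> [a b|K T TK].
  apply/funext => p; apply/funext => q; rewrite /opsub /dual_coaction.
  by case: ifP; rewrite ?subr0.
apply: (opnorm_pull TK) => F.
pose k (p : G * Gam) := ((cocycle p.1)^-1 * p.2)%g.
have kI p q : k p = k q -> p.1 = q.1 -> p = q.
  by case: p q => [g s] [g' s'] /= + E; rewrite /k /= E => /mulgI ->.
have sq (c : bool) : `|c%:R : C| ^+ 2 = c%:R.
  by case: c; rewrite ?normr1 ?normr0 ?expr1n ?expr0n.
have sub p : p \in F -> k p \in undup [seq k p | p <- F].
  by move=> pF; rewrite mem_undup map_f.
exists (undup [seq k p | p <- F]), (fun w p => (w == k p)%:R), (fun w p => (w == k p)%:R),
  (fun _ => fst), (fun _ => fst).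
have inj w : {in F &, forall p q, (w == k p)%:R != 0 :> C -> (w == k q)%:R != 0 :> C ->
    p.1 = q.1 -> p = q}.
  move=> p q _ _; case: (w =P k p) => [wp|]; last by rewrite eqxx.
  by case: (w =P k q) => [wq|]; rewrite ?eqxx // => _ _; apply: kI; rewrite -wp.
split=> // [p q pF qF|p pF|p pF].
- rewrite (bigD1_seq (k p)) ?undup_uniq ?sub //= eqxx mul1r big1 ?addr0.
    by rewrite /dual_coaction -!/(k _); case: eqP; rewrite ?mulr1 ?mulr0.
  by move=> w /negPf ->; rewrite !mul0r.
- by under eq_bigr do rewrite sq; rewrite sum_pred1 ?undup_uniq ?sub.
- by under eq_bigr do rewrite sq; rewrite sum_pred1 ?undup_uniq ?sub.
Qed.

Lemma dual_coaction_fourier t a :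
  dual_coaction (fourier t a) = optensor (fourier t a) (lambda t).
Proof.
apply/funext => -[g s]; apply/funext => -[h r].
rewrite /dual_coaction /optensor /left_regular /fourier /schur /=.
case: (_ =P t) => [E|_]; last by rewrite !mul0r if_same.
have cg : cocycle g = (t * cocycle h)%g by rewrite -E mulgVK.
have -> : ((cocycle g)^-1 * s == (cocycle h)^-1 * r)%g = (s == t * r)%g.
  have <- : ((t * cocycle h)^-1 * (t * r) = (cocycle h)^-1 * r)%g.
    by apply: (mulgI (t * cocycle h)%g); rewrite mulVKg -mulgA mulVKg.
  by rewrite cg (inj_eq (mulgI _)).
by case: eqP; rewrite ?mulr1 ?mulr0 ?mul1r.
Qed.

Lemma left_regular_norm t : opnorm_le 1 (lambda t).
Proof.
have nz s r : lambda t s r != 0 -> s = (t * r)%g.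
  by rewrite /left_regular; case: (s =P _) => // _; rewrite eqxx.
apply: opnorm_monomial => // [s r|s r r' /nz -> /nz /mulgI //|s s' r /nz -> /nz -> //].
by rewrite /left_regular; case: eqP; rewrite ?normr1 ?normr0 ?ler01.
Qed.

Lemma left_regular_mem t : group_Cstar (lambda t).
Proof. by apply/sub_opclosure/sub_opspan; exists t. Qed.

Lemma tensor_closure_subspace (I J : choiceType) (A : set (opmatrix R I))
    (B : set (opmatrix R J)) : opsubspace (tensor_closure A B).
Proof. exact/opsubspace_closure/opsubspace_span. Qed.

Lemma tensor_closure_mem (I J : choiceType) (A : set (opmatrix R I))
    (B : set (opmatrix R J)) T S : A T -> B S -> tensor_closure A B (optensor T S).
Proof. by move=> AT BS; apply/sub_opclosure/sub_opspan; exists T => //; exists S. Qed.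

(** By Fejer summation, since the coaction is a contraction that takes the t-th
  Fourier coefficient of a to its tensor product with lambda_t. *)
Lemma dual_coaction_mem (M : set (opmatrix R G)) a : amenable_group R Gam ->
  Cr a -> (forall t, M (fourier t a)) ->
  tensor_closure M (@group_Cstar R Gam) (dual_coaction a).
Proof.
move=> am aC Ma.
have sub T : opspan [set fourier t a | t in [set: Gam]] T ->
    tensor_closure M (@group_Cstar R Gam) (dual_coaction T).
  have [t0 tD tZ] := tensor_closure_subspace M (@group_Cstar R Gam).
  apply: (@opspan_min R _ _
    [set T | tensor_closure M (@group_Cstar R Gam) (dual_coaction T)]).
    split=> [|U V hU hV|z U hU] /=.
    - rewrite (_ : dual_coaction _ = @opzero R (G * Gam)%type) //.
      by apply/funext => p; apply/funext => q; rewrite /dual_coaction if_same.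
    - by rewrite dual_coactionD; apply: tD.
    - by rewrite dual_coactionZ; apply: tZ.
  move=> _ [t _ <-] /=; rewrite dual_coaction_fourier; apply: tensor_closure_mem => //.
  exact: left_regular_mem.
have := opclosure_map dual_coaction_contraction _ (fejer am aC).
move=> /(_ (tensor_closure M (@group_Cstar R Gam))) h.
apply: (opclosureS _ (h _)) => [T hT|T hT]; first exact: hT.
exact/sub_opclosure/sub.
Qed.

Lemma gunit_cts : continuous (gunit beta).
Proof.
move=> x A; have tx : pdom beta 1^-1%g x by rewrite invg1 pdom1.
have -> : gunit beta x = arrow tx by apply: groupoid_ext.
move=> /arrow_near; apply: filterS => y h.
have ty : pdom beta 1^-1%g y by rewrite invg1 pdom1.
by have := h ty; rewrite (_ : arrow ty = gunit beta y) //; apply: groupoid_ext.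
Qed.

Lemma continuous_src (w : X -> C) : continuous (w : X -> C^o) ->
  continuous ((fun g : G => w (src g)) : G -> C^o).
Proof.
move=> wc g; exact: (@cvg_comp _ _ _ (@src _ _ beta) (w : X -> C^o) _ _ _
  (src_cts (x := g)) (wc (src g))).
Qed.

Lemma CcM f (k : G -> C) : Cc f -> continuous (k : G -> C^o) -> Cc (fun g => f g * k g).
Proof.
move=> [fc fs] kc; split; first exact (continuousCM fc kc).
apply: subclosed_compact fs _; first exact: closed_closure.
by apply: closure_subset => g /=; rewrite mulf_eq0 negb_or => /andP[].
Qed.

(** The unit space is the fibre of the cocycle over 1, hence clopen in G, and
  homeomorphic to X: a function in C_c (X), extended by zero, is in C_c (G). *)
Lemma diag_op_Cr (w : X -> C) (K : set X) : continuous (w : X -> C^o) ->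
  compact K -> (forall x, ~ K x -> w x = 0) -> Cr (diag_op w : opmatrix R G).
Proof.
move=> wc cK Kw; apply: Ind_Cr.
pose L : set G := [set g | cocycle g = 1%g /\ K (src g)].
have clK : closed K by apply: compact_closed.
have clL : closed L.
  apply: closedI.
    apply: (@preimage_closed _ _ (@cocycle _ _ beta : G -> discrete_topology Gam)
      [set (1%g : Gam)]); last exact: discrete_closed.
    by move=> g _; apply: cocycle_cts.
  by apply: (@preimage_closed _ _ (@src _ _ beta) K) => // g _; apply: src_cts.
have cL : compact L.
  have : compact (gunit beta @` K).
    by apply: continuous_compact cK; apply: continuous_subspaceT; exact: gunit_cts.
  move=> cB; apply: (subclosed_compact clL cB) => g [cg Kg]; exists (src g) => //.
  exact: groupoid_ext.
have -> : (fun g : G => if cocycle g == 1%g then w (src g) else 0) =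
    (fun g => (cocycle g == 1%g)%:R * w (src g)).
  by apply/funext => g; case: eqP; rewrite ?mul1r ?mul0r.
split.
  exact (continuousCM (@continuous_cocycle R Gam X beta (fun s => (s == 1%g)%:R))
    (continuous_src wc)).
apply: subclosed_compact cL _; first exact: closed_closure.
rewrite ((closure_id L).1 clL); apply: closure_subset => g /=.
rewrite mulf_eq0 negb_or => /andP[]; case: (cocycle g =P _) => [cg _|_]; last by rewrite eqxx.
move=> wg; split=> //; apply: contrapT => /Kw E; by rewrite E eqxx in wg.
Qed.

(** f is close to f w for w = |f|^2 / (|f|^2 + e^2), since
  |f| e^2 / (|f|^2 + e^2) is at most e. *)
Lemma fibre_factor f t (e : R) : Cc f -> (forall g, cocycle g <> t -> f g = 0) ->
  0 < e -> exists2 w : X -> C, Cr (diag_op w : opmatrix R G) &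
    opnorm_le e (opsub (Ind f) (opmul (Ind f) (diag_op w))).
Proof.
move=> fC ft e0; have [bc [K cK Kb]] := Cc_fibre_fun X_T2 t fC.
pose bet := fibre_fun t f; pose d x : C := `|bet x| ^+ 2 + (e ^+ 2)%:C.
have eC : 0 < e%:C by rewrite ltcR.
have e2 : 0 < (e ^+ 2)%:C by rewrite ltcR exprn_gt0.
have dp x : 0 < d x by rewrite ltr_wpDl // exprn_ge0.
have dn x : d x != 0 by rewrite gt_eqF.
pose w x := `|bet x| ^+ 2 * (d x)^-1.
have wc : continuous (w : X -> C^o).
  have dc := continuousCD (continuousC_sqnorm bc) (@continuousC_cst R _ (e ^+ 2)%:C).
  exact (continuousCM (continuousC_sqnorm bc) (continuousCV dc dn)).
have Kw x : ~ K x -> w x = 0 by move=> /Kb; rewrite /w /bet => ->; rewrite normr0 expr0n mul0r.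
exists w; first exact: diag_op_Cr wc cK Kw.
have fw : opmul (Ind f) (diag_op w) = Ind (fun g => f g * w (src g)).
  apply/funext => g; apply/funext => h; rewrite opmul_diag.
  have [E|E] := pselect (src g = src h); last by rewrite !Ind_out // mul0r.
  by rewrite !IndE //; have [-> _ _] := gdivP E.
have fwC : Cr (opsub (Ind f) (opmul (Ind f) (diag_op w)) : opmatrix R G).
  apply: (opsubspace_sub (Cr_subspace R beta)); first exact: Ind_Cr.
  rewrite fw; apply: Ind_Cr; exact (CcM fC (continuous_src wc)).
have cE g : coef (opsub (Ind f) (opmul (Ind f) (diag_op w))) g = f g * (1 - w (src g)).
  have -> : coef (opsub (Ind f) (opmul (Ind f) (diag_op w))) g =
    coef (Ind f) g - coef (opmul (Ind f) (diag_op w)) g by [].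
  by rewrite coef_opmul_diag coef_Ind mulrBr mulr1.
apply: (@fibre_norm _ _ _ _ _ t) => //; first exact: ltW.
  by move=> g ct; rewrite cE ft // mul0r.
move=> g; rewrite cE; have [ct|ct] := pselect (cocycle g = t); last first.
  by rewrite ft // mul0r normr0 ler0c ltW.
have -> : 1 - w (src g) = (e ^+ 2)%:C / d (src g).
  by apply: (mulIf (dn (src g))); rewrite mulrBl mul1r /w !divfK // /d addrC addKr.
rewrite normrM normf_div (gtr0_norm e2) (gtr0_norm (dp _)) mulrA ler_pdivrMr //.
rewrite /d /bet fibre_funE // rmorphXn /=.
have := normr_ge0 (f g); move: `|f g| => u u0; rewrite -subr_ge0.
have -> : e%:C * (u ^+ 2 + e%:C ^+ 2) - u * e%:C ^+ 2 =
   e%:C * ((u - e%:C / 2) ^+ 2 + 3 / 4 * e%:C ^+ 2) by field.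
have sq : 0 <= (u - e%:C / 2) ^+ 2.
  by rewrite real_exprn_even_ge0 // rpredB // ger0_real // divr_ge0 // ltW.
have q : 0 <= 3 / 4 * e%:C ^+ 2 by rewrite mulr_ge0 ?divr_ge0 // exprn_ge0 // ltW.
by apply: mulr_ge0; [exact: ltW | exact: addr_ge0].
Qed.

Lemma opspan_left_regular_bounded S : opspan (range lambda) S ->
  exists2 K : R, 0 < K & opnorm_le K S.
Proof.
move=> [n [z [T [TA ->]]]].
have /choice[K KP] : forall l, exists K : R, opnorm_le K (opscale (z l) (T l)).
  move=> l; have [r r0 rE] := normC_real (z l); exists (r * 1).
  by apply: opnormZ; [rewrite rE | have [t _ <-] := TA l; exact: left_regular_norm].
exists (1 + \sum_(l <- index_enum 'I_n) K l).
  rewrite ltr_pwDl //; apply: sumr_ge0 => l _; by have [] := KP l.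
apply: (@opnorm_leW _ _ (\sum_(l <- index_enum 'I_n) K l)); first by rewrite lerDr.
by apply: (opnorm_sum (T := fun l => opscale (z l) (T l))).
Qed.

Lemma group_Cstar_bounded S : @group_Cstar R Gam S -> exists2 K : R, 0 < K & opnorm_le K S.
Proof.
move=> SC; have [S' S'A SS'] := SC 1 ltr01.
have [K K0 KS'] := opspan_left_regular_bounded S'A.
exists (1 + K); first by rewrite ltr_pwDl // ltW.
have -> : S = opadd (opsub S S') S'.
  by apply/funext => i; apply/funext => j; rewrite /opadd /opsub subrK.
exact: opnormD.
Qed.

Lemma optensorBl (I J : choiceType) (T T' : opmatrix R I) (S : opmatrix R J) :
  optensor (opsub T T') S = opsub (optensor T S) (optensor T' S).
Proof. by apply/funext => p; apply/funext => q; rewrite /optensor /opsub mulrBl. Qed.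

Lemma optensorBr (I J : choiceType) (T : opmatrix R I) (S S' : opmatrix R J) :
  optensor T (opsub S S') = opsub (optensor T S) (optensor T S').
Proof. by apply/funext => p; apply/funext => q; rewrite /optensor /opsub mulrBr. Qed.

Lemma optensor_subspacer (I J : choiceType) (B : set (opmatrix R (I * J)%type))
    (T : opmatrix R I) : opsubspace B -> opsubspace [set S | B (optensor T S)].
Proof.
move=> [B0 BD BZ]; split=> [|U V hU hV|z U hU] /=.
- rewrite (_ : optensor _ _ = @opzero R (I * J)%type) //.
  by apply/funext => p; apply/funext => q; rewrite /optensor mulr0.
- rewrite (_ : optensor _ _ = opadd (optensor T U) (optensor T V)); first exact: BD.
  by apply/funext => p; apply/funext => q; rewrite /optensor /opadd mulrDr.
- rewrite (_ : optensor _ _ = opscale z (optensor T U)); first exact: BZ.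
  by apply/funext => p; apply/funext => q; rewrite /optensor /opscale mulrCA.
Qed.

Lemma Ind_fourier_sum f (S : seq Gam) : uniq S ->
  (forall g, cocycle g \notin S -> f g = 0) ->
  Ind f = fun g h => \sum_(t <- S) fourier t (Ind f) g h.
Proof.
move=> uS fS; transitivity (schur (fun=> 1) (Ind f : opmatrix R G)).
  by apply/funext => g; apply/funext => h; rewrite /schur mul1r.
rewrite (@schur_sum _ _ _ _ _ S) //; last first.
  by move=> t tS; right; apply: fourier_Ind0 => g ct; apply: fS; rewrite ct.
apply/funext => g; apply/funext => h; apply: eq_bigr => t _.
by rewrite /opscale mul1r.
Qed.

(** Closedness allows replacing a and S in a (x) S by f in C_c and by a finite
  combination of the lambda_t; one fibre at a time, f (x) lambda_t is close to
  delta (f) (e (x) lambda_(s^-1 t)). *)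
Lemma dual_coaction_nondegenerate (B : set (opmatrix R (G * Gam)%type)) :
  opsubspace B -> opclosure B `<=` B ->
  (forall a z, Cr a -> @tensor_alg R Gam X beta z -> B (opmul (dual_coaction a) z)) ->
  @tensor_alg R Gam X beta `<=` B.
Proof.
move=> Bs Bcl Bmul; have [B0 BD BZ] := Bs.
have step1 f s t : Cc f -> (forall g, cocycle g <> s -> f g = 0) ->
    B (optensor (Ind f) (lambda t)).
  move=> fC fs; apply: Bcl => e e0.
  have [w wC fw] := fibre_factor fC fs e0.
  pose z := optensor (diag_op w : opmatrix R G) (lambda (s^-1 * t)%g).
  exists (opmul (dual_coaction (Ind f)) z).
    apply: Bmul; first exact: Ind_Cr.
    by apply: tensor_closure_mem => //; exact: left_regular_mem.
  have If : fourier s (Ind f) = Ind f :> opmatrix R G.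
    rewrite /fourier schur_Ind; congr Ind; apply/funext => g.
    by case: eqP => [_|/fs ->]; rewrite ?mul1r ?mulr0.
  have -> : opmul (dual_coaction (Ind f)) z =
      optensor (opmul (Ind f) (diag_op w)) (lambda t).
    apply/funext => p; apply/funext => q.
    pose k := (q.1, (s^-1 * t) * q.2)%g.
    rewrite {1}/opmul (summability_sum1 (i0 := k)).
      have -> : z k q = w (rng q.1).
        by rewrite /z /optensor /= diag_opE asboolT // /left_regular eqxx mulr1.
      rewrite -If dual_coaction_fourier If /optensor opmul_diag /left_regular /=.
      by rewrite -!mulgA mulVKg mulrAC.
    move=> [g r] nk; rewrite /z /optensor /= diag_opE /left_regular.
    case: asboolP => [E|_]; last by rewrite mul0r mulr0.
    case: eqP => [E'|_]; last by rewrite !mulr0.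
    by rewrite E E' eqxx in nk.
  rewrite -optensorBl -[e]mulr1; apply: opnorm_tensor => //; exact: left_regular_norm.
have step2 f t : Cc f -> B (optensor (Ind f) (lambda t)).
  move=> fC; have [S [K [_ fS _]]] := Cc_finite fC.
  have fS' g : cocycle g \notin undup S -> f g = 0 by rewrite mem_undup; apply: fS.
  have -> : optensor (Ind f) (lambda t) = fun p q =>
      \sum_(u <- undup S) optensor (fourier u (Ind f)) (lambda t) p q.
    rewrite {1}(Ind_fourier_sum (undup_uniq S) fS').
    by apply/funext => p; apply/funext => q; rewrite /optensor mulr_suml.
  apply: (opsubspace_sum (f := fun u => optensor (fourier u (Ind f)) (lambda t))) => // u _.
  rewrite /fourier schur_Ind; apply: (step1 _ u); first exact: (CcZ (fun s => (s == u)%:R) fC).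
  by move=> g cu; case: eqP; rewrite ?mul0r.
have step3 f S : Cc f -> group_Cstar S -> B (optensor (Ind f) S).
  move=> fC SC; have [K K0 fK] := Cr_bounded (Ind_Cr fC).
  apply: Bcl => e e0; have [S' S'A SS'] := SC _ (divr_gt0 e0 K0).
  exists (optensor (Ind f) S').
    apply: (opspan_min (optensor_subspacer (Ind f) Bs) _ S'A) => _ [t _ <-] /=.
    exact: step2.
  rewrite -optensorBr -(@divfK _ K _ e) ?gt_eqF // [e / K * K]mulrC.
  by apply: opnorm_tensor => //; apply: divr_gt0.
apply: (subset_trans _ Bcl); apply: opclosureS; apply: opspan_min.
  exact: opsubspace_closure.
move=> _ [T TC [S SC <-]]; apply: sub_opclosure.
have [L L0 SL] := group_Cstar_bounded SC.
apply: Bcl => e e0; have [_ [f fC <-] Tf] := TC _ (divr_gt0 e0 L0).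
exists (optensor (Ind f) S); first exact: step3.
rewrite -optensorBl -(@divfK _ L _ e) ?gt_eqF //.
by apply: opnorm_tensor => //; apply: divr_gt0.
Qed.

Lemma dual_coaction_is_coaction : amenable_group R Gam ->
  is_coaction (dual_coaction : opmatrix R G -> _).
Proof.
move=> am; split.
- split=> [a aC|a b _ _|z a _|a b _ _|a _].
  + by apply: dual_coaction_mem => // t; apply: fourier_Cr.
  + exact: dual_coactionD.
  + exact: dual_coactionZ.
  + exact: dual_coactionM.
  + exact: dual_coaction_adj.
- by move=> a K _; apply: dual_coaction_contraction.2.
- apply: dual_coaction_nondegenerate.
  + exact/opsubspace_closure/opsubspace_span.
  + exact: opclosureS.
  + by move=> a z aC zC; apply/sub_opclosure/sub_opspan; exists a => //; exists z.
- move=> f t fC ft; have <- : fourier t (Ind f) = Ind f :> opmatrix R G.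
    rewrite /fourier schur_Ind; congr Ind; apply/funext => g.
    case: eqP => [_|ct]; rewrite ?mul1r // mul0r.
    by rewrite support_ofN // => /ft.
  exact: dual_coaction_fourier.
Qed.

(** A coaction is determined on C_c by its values on functions carried by one
  fibre, then on C*_r by continuity. *)
Lemma delta_cE a : amenable_group R Gam -> Cr a -> delta_c a = dual_coaction a.
Proof.
move=> am aC; have [dB dN] := dual_coaction_contraction.
have : is_coaction (@delta_c R Gam X beta).
  apply: xgetPex; exists dual_coaction; exact: dual_coaction_is_coaction.
move: (@delta_c R Gam X beta) => D [[_ DD DZ _ _] DN _ Dgen].
have Crs := Cr_subspace R beta; have [Cr0 CrD CrZ] := Crs.
have DB b c : Cr b -> Cr c -> D (opsub b c) = opsub (D b) (D c).
  by move=> bC cC; rewrite opsub_opadd DD ?DZ -?opsub_opadd //; apply: CrZ.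
have Df f : Cc f -> D (Ind f) = dual_coaction (Ind f).
  move=> fC; have [S [K [_ fS _]]] := Cc_finite fC.
  have fS' g : cocycle g \notin undup S -> f g = 0 by rewrite mem_undup; apply: fS.
  rewrite (Ind_fourier_sum (undup_uniq S) fS').
  have IfC u : Cr (fourier u (Ind f) : opmatrix R G) by apply/fourier_Cr/Ind_Cr.
  elim: (undup S) => [|u s IH].
    have E : (fun g h => \sum_(t <- [::]) fourier t (Ind f) g h) =
        opscale 0 (@opzero R G).
      by apply/funext => g; apply/funext => h; rewrite big_nil /opscale mul0r.
    rewrite E DZ // dual_coactionZ.
    by apply/funext => p; apply/funext => q; rewrite /opscale !mul0r.
  have E : (fun g h => \sum_(t <- u :: s) fourier t (Ind f) g h) =
      opadd (fourier u (Ind f)) (fun g h => \sum_(t <- s) fourier t (Ind f) g h).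
    by apply/funext => g; apply/funext => h; rewrite big_cons.
  rewrite E DD // ?IH ?dual_coactionD; last by apply: opsubspace_sum.
  rewrite dual_coaction_fourier; congr opadd; rewrite /fourier schur_Ind.
  apply: Dgen; first exact: (CcZ (fun s => (s == u)%:R) fC).
  have clt : closed [set g : G | cocycle g = u].
    apply: (@preimage_closed _ _ (@cocycle _ _ beta : G -> discrete_topology Gam)
      [set u]); last exact: discrete_closed.
    by move=> g _; apply: cocycle_cts.
  rewrite ((closure_id _).1 clt); apply: closure_subset => g /=.
  by case: (cocycle g =P u) => // _; rewrite mul0r eqxx.
apply/funext => p; apply/funext => q; apply/eqP; rewrite -subr_eq0; apply/eqP.
apply: eq0_of_small => e e0; have e20 : 0 < e / 2 by rewrite divr_gt0.
have [_ [f fC <-] af] := aC _ e20; have fCr := Ind_Cr fC.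
apply: (@opnorm_entry _ _ e (opsub (D a) (dual_coaction a)) p q).
rewrite (splitr e); apply: (@opnorm_sub_trans _ _ (D (Ind f))).
  by rewrite -DB //; apply: DN => //; exact: (opsubspace_sub Crs).
by rewrite Df // -dB; apply: dN; exact: opnorm_subC.
Qed.

(** The slice map id (x) <. delta_1, delta_t> sends delta (a) to the Fourier
  coefficient of a at t. *)
Lemma fourier_of_delta (M : set (opmatrix R G)) t a : amenable_group R Gam ->
  diagonal_bimodule M -> delta_invariant M -> M a -> M (fourier t a).
Proof.
move=> am Mb inv Ma; have [MC _ Mcl _] := Mb.
have Ms := bimodule_subspace Mb; have [M0 MD MZ] := Ms.
pose slice (T : opmatrix R (G * Gam)%type) : opmatrix R G :=
  fun g h => T (g, t) (h, 1%g).
have -> : fourier t a = slice (dual_coaction a).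
  apply/funext => g; apply/funext => h; rewrite /slice /dual_coaction /fourier /schur /=.
  have -> : ((cocycle g)^-1 * t == (cocycle h)^-1 * 1)%g = (cocycle g / cocycle h == t)%g.
    rewrite mulg1; apply/eqP/eqP => [<-|<-]; first by rewrite mulVKg.
    by rewrite mulKg.
  by case: eqP; rewrite ?mul1r ?mul0r.
have aC := MC a Ma; rewrite -delta_cE //.
have : tensor_closure M (@group_Cstar R Gam) (delta_c a) by apply: inv; exists a.
move=> h; apply: Mcl; apply: (opclosure_map _ _ h).
  split=> // K T TK; apply: (opnorm_pull TK) => F.
  exists [:: tt], (fun _ _ => 1), (fun _ _ => 1), (fun _ g => (g, t)), (fun _ h => (h, 1%g)).
  split=> [g k _ _|_ g k _ _ _ _ []|_ g k _ _ _ _ []|g _|g _] //;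
    by rewrite big_seq1 ?mul1r ?mulr1 // normr1 expr1n.
move=> T hT; apply: sub_opclosure.
apply: (@opspan_min R _ _ [set T | M (slice T)] _ _ _ hT).
  by split=> [|U V|z U] /=; [exact: M0 | exact: MD | exact: MZ].
move=> _ [m Mm [S SC <-]] /=.
rewrite (_ : slice _ = opscale (S t 1%g) m); first exact: MZ.
by apply/funext => g; apply/funext => k; rewrite /slice /optensor /opscale mulrC.
Qed.

End Coaction.

(** * The theorem *)

Section SpectralInvariant.
Variables (R : realType) (Gam : groupType) (X : topologicalType).
Variable beta : partial_action Gam X.
Local Notation C := (R[i]).
Local Notation G := (groupoid beta).
Variable M : set (opmatrix R G).
Hypothesis M_spectral : spectral M.

Lemma spectral_schur (phi : Gam -> C) a :
  opcontraction (schur phi : opmatrix R G -> opmatrix R G) -> M a -> M (schur phi a).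
Proof.
rewrite M_spectral => pc [aC a0]; split; first exact: schur_Cr.
by move=> g /a0; rewrite coef_schur => ->; rewrite mulr0.
Qed.

Lemma alpha_invariant_of_spectral : alpha_invariant M.
Proof.
move=> chi chic _ [a Ma <-]; have aC : Cr a by move: Ma; rewrite M_spectral => -[].
rewrite alphaE //; apply: spectral_schur => //; exact: character_contraction.
Qed.

Lemma delta_invariant_of_spectral : hausdorff_space X -> amenable_group R Gam ->
  delta_invariant M.
Proof.
move=> X_T2 am _ [a Ma <-]; have aC : Cr a by move: Ma; rewrite M_spectral => -[].
rewrite delta_cE //; apply: dual_coaction_mem => // t.
by apply: spectral_schur => //; exact: fourier_contraction.
Qed.

End SpectralInvariant.

Theorem corollary4p13 (R : realType) (X : topologicalType) (Gam : groupType)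
  (beta : partial_action Gam X) (M : set (opmatrix R (groupoid beta)))
  (X_sc : second_countable (T := X)) (X_lc : locally_compact [set: X])
  (X_T2 : hausdorff_space X)
  (Gam_countable : countable [set: Gam]) (Gam_amenable : amenable_group R Gam)
  (M_bimod : diagonal_bimodule M) :
  (abelian_group Gam -> (spectral M <-> alpha_invariant M)) /\
  (~ abelian_group Gam -> (spectral M <-> delta_invariant M)).
Proof.
split=> [mulC|_]; split=> [Ms|inv].
- exact: alpha_invariant_of_spectral.
- apply: spectral_of_fourier => // t a; exact: fourier_of_alpha.
- exact: delta_invariant_of_spectral.
- apply: spectral_of_fourier => // t a; exact: fourier_of_delta.
Qed.
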